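(* Let $m<p$ be positive integers, $\Sigma_m=\{0,1,\dots,m\}$, $\Sigma_m^+=\{1,\dots,m\}$, and let $f:\Sigma_m\to\{0,1,\dots,p\}$ be strictly increasing with $f(0)=0$ and $f(m)=p$. Let $\{C_n\}_{n\ge 0}$ be the associated Cantor-integers and $\alpha=\log(p+1)/\log(m+1)$. Then \[\sup_{n\ge1}\frac{C_n}{n^\alpha}=\max_{\epsilon\in\Sigma_m^+}\frac{C_\epsilon}{\epsilon^\alpha}\quad\text{and}\quad \inf_{n\ge1}\frac{C_n}{n^\alpha}=\min_{1\le n<(m+1)^{\ell_0}}\frac{C_n+1}{(n+1)^\alpha},\] where $\ell_0$ is the smallest positive integer satisfying \[\alpha\frac{(f(m)+1)^{\ell_0}}{(m+1)^{\ell_0+1}}\ \ge\ \max_{\epsilon\in\Sigma_m\setminus\{m\}}\frac{f(m)-f(\epsilon)}{m-\epsilon}.\] In particular, if moreover there are integers $a,b$ with $f(x)=ax^2+bx$ for all $x\in\Sigma_m$ and $2ax+b>0$ for every real $x\in[1,m]$, then \[\inf_{n\ge1}\frac{C_n}{n^\alpha}=\min_{1\le n<(m+1)^2}\frac{C_n+1}{(n+1)^\alpha}=\begin{cases}1,&\text{if } a\le 0,\\ \min\Big\{1,\ \min_{\epsilon\in\Sigma_m}\dfrac{C_{m+\epsilon+1}+1}{(m+\epsilon+2)^\alpha}\Big\},&\text{if } a>0.\end{cases}\]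
   Context: Cantor-integers: for an integer $n\ge0$ with base-$(m+1)$ expansion $n=\sum_{j=0}^k\epsilon_j(m+1)^j$, $\epsilon_j\in\Sigma_m$, define $C_n=\sum_{j=0}^k f(\epsilon_j)(p+1)^j$ (i.e. the base-$(p+1)$ digits of $C_n$ are obtained by applying $f$ to the base-$(m+1)$ digits of $n$). The function $f$ is called the base conversion function. *)

(* Defs.v *)
From mathcomp Require Import all_boot all_order all_algebra.
From mathcomp Require Import all_classical all_reals all_analysis.

Set Implicit Arguments.
Unset Strict Implicit.
Unset Printing Implicit Defensive.

Import Order.TTheory GRing.Theory Num.Theory.

Local Open Scope ring_scope.

Section CantorIntegers.
Variables (R : realType) (m p : nat).

(* [inZp] reduces modulo [m.+1]. *)
Definition digit (n j : nat) : 'I_m.+1 := inZp (n %/ m.+1 ^ j).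

(* For [0 < m], the base-[m.+1] expansion of [n] has leading position
   [trunc_log m.+1 n]; for [n = 0] this leaves the single digit [0]. *)
Definition cantor_int (f : 'I_m.+1 -> 'I_p.+1) (n : nat) : nat :=
  (\sum_(j < (trunc_log m.+1 n).+1) f (digit n j) * p.+1 ^ j)%N.

Definition alpha : R := ln p.+1%:R / ln m.+1%:R.

Variable f : 'I_m.+1 -> 'I_p.+1.

Definition ratio (n : nat) : R := (cantor_int f n)%:R / n%:R `^ alpha.

Definition succ_ratio (n : nat) : R :=
  ((cantor_int f n)%:R + 1) / (n%:R + 1) `^ alpha.

Definition end_slope (e : 'I_m.+1) : R :=
  ((f ord_max)%:R - (f e)%:R) / (m%:R - e%:R).

(* A [\big[Num.max/x]] or [\big[Num.min/x]] is the plain maximum or minimum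
   of the range as soon as [x] is one of the values; here [ord0 != ord_max]
   when [0 < m]. *)
Definition max_end_slope : R :=
  \big[Num.max/end_slope ord0]_(e : 'I_m.+1 | e != ord_max) end_slope e.

Definition level_cond (l : nat) : Prop :=
  max_end_slope <=
    alpha * (((f ord_max)%:R + 1) ^+ l / (m%:R + 1) ^+ l.+1).

Definition is_least_level (l : nat) : Prop :=
  [/\ (0 < l)%N, level_cond l &
      forall k : nat, (0 < k)%N -> level_cond k -> (l <= k)%N].

Definition max_ratio_digit : R :=
  \big[Num.max/ratio 1]_(1 <= e < m.+1) ratio e.

Definition min_succ_ratio (l : nat) : R :=
  \big[Num.min/succ_ratio 1]_(1 <= n < (m.+1 ^ l)%N) succ_ratio n.

Definition min_succ_ratio_two_digits : R :=
  \big[Num.min/succ_ratio (m + 0 + 1)]_(e : 'I_m.+1) succ_ratio (m + e + 1).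

Definition sup_ratio : \bar R :=
  ereal_sup [set (ratio n)%:E | n in [set n : nat | (1 <= n)%N]]%classic.

Definition inf_ratio : \bar R :=
  ereal_inf [set (ratio n)%:E | n in [set n : nat | (1 <= n)%N]]%classic.

End CantorIntegers.

(* Main.v *)
(* Write q = m + 1 and P = p + 1, so that q^alpha = P.  As C (q n + e) is
   P * C n + f e, superadditivity of x^alpha propagates C n <= M n^alpha from
   the digits to all n; this is the supremum.

   For the infimum, appending zeros to n leaves C n / n^alpha unchanged,
   appending digits m leaves (C n + 1) / (n + 1)^alpha unchanged, and along such
   a sequence the two ratios become equal in the limit: they have the same lower
   bounds.  Hence it suffices to know from which length on appending a digit e
   cannot decrease (C n + 1) / (n + 1)^alpha, which is the inequality
   p - f e <= (C n + 1) * P * (1 - s^alpha) with s = 1 - (m - e) / (q (n + 1)).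
   It is clear if s^alpha <= C n / (C n + 1); otherwise it follows from
   1 - s^alpha >= alpha (1 - s) s^alpha and the condition defining l_0.

   For f = a x^2 + b x the least l_0 may exceed 2 (it is 4 for f = x^2, m = 2).
   If a <= 0 or m = 1, then f lies above its chord and convexity of x^alpha gives
   C n + 1 >= (n + 1)^alpha.  If a > 0 and m >= 2, then alpha >= 4/3, and this
   bound yields the step inequality for all n >= m.  For a two-digit number with
   digits u, v the ratio is (f u + r) / (u + s)^alpha, where r = (f v + 1) / P and
   s = (v + 1) / q.  When alpha >= 2, this function of a real u in [1, m] is at
   least the smaller of its values at the ends; alpha < 2 leaves, for m >= 3, only
   f = x^2 and f = x^2 + x, which are compared with leading digit 1 directly. *)

Require Import Defs.
From mathcomp Require Import all_boot all_order all_algebra.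
From mathcomp Require Import all_classical all_reals all_analysis.
From mathcomp Require Import zify ring lra.

Set Implicit Arguments.
Unset Strict Implicit.
Unset Printing Implicit Defensive.

Import Order.TTheory GRing.Theory Num.Theory.
Import numFieldNormedType.Exports.

Local Open Scope ring_scope.

(** * Digit recursion for Cantor-integers *)

Section CantorInt.
Variables (m p : nat) (f : 'I_m.+1 -> 'I_p.+1).
Hypothesis m_gt0 : (0 < m)%N.
Hypothesis f0 : f ord0 = 0%N :> nat.

(** Digits above the leading one are [0] and [f] fixes [0], so the sum may be padded to any length;
    this lets numbers of different lengths be compared term by term. *)
Lemma cantor_int_widen n K : (trunc_log m.+1 n < K)%N ->
  cantor_int f n = (\sum_(j < K) f (digit m n j) * p.+1 ^ j)%N.
Proof.
move=> ltK; rewrite /cantor_int.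
rewrite (big_ord_widen K (fun j => f (digit m n j) * p.+1 ^ j)%N) //.
rewrite big_mkcond; apply: eq_bigr => j _.
case: ltnP => // lt_j.
have -> : digit m n j = ord0.
  apply: val_inj; rewrite /= divn_small ?mod0n //.
  by apply: leq_trans (trunc_log_ltn n _) (leq_pexp2l _ lt_j).
by rewrite f0 mul0n.
Qed.

Lemma cantor_int_rec n (e : 'I_m.+1) :
  cantor_int f (m.+1 * n + e) = (p.+1 * cantor_int f n + f e)%N.
Proof.
set K := (trunc_log m.+1 (m.+1 * n + e)).+1.
have leK : (trunc_log m.+1 n < K)%N.
  by rewrite ltnS leq_trunc_log // (leq_trans _ (leq_addr _ _)) // leq_pmull.
rewrite (cantor_int_widen leK) (cantor_int_widen (leqnSn K)).
rewrite big_ord_recl /= expn0 muln1 addnC; congr (_ + _)%N; last first.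
  by congr (f _ : nat); apply: val_inj; rewrite /= divn1 mulnC modnMDl modn_small.
rewrite big_distrr; apply: eq_bigr => j _ /=.
rewrite /bump /= add1n expnS [RHS]mulnCA; congr (f _ * _)%N; apply: val_inj => /=.
by rewrite expnS divnMA (mulnC m.+1 n) divnMDl // (divn_small (ltn_ord e)) addn0.
Qed.

Lemma cantor_int_digit (e : 'I_m.+1) : cantor_int f e = f e.
Proof.
have C0 : cantor_int f 0 = 0%N.
  rewrite /cantor_int trunc_log0 big_ord_recl big_ord0 /= muln1 addn0 -[RHS]f0.
  by congr (f _ : nat); apply: val_inj; rewrite /= div0n mod0n.
by have := cantor_int_rec 0 e; rewrite muln0 add0n C0 muln0.
Qed.

Lemma digit_ind (Q : nat -> Prop) :
  (forall e : 'I_m.+1, Q e) ->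
  (forall n (e : 'I_m.+1), (0 < n)%N -> Q n -> Q (m.+1 * n + e)%N) ->
  forall n, Q n.
Proof.
move=> Qd Qr; elim/ltn_ind => n IH.
have [ltn|len] := ltnP n m.+1; first exact: (Qd (Ordinal ltn)).
have lt_r : (n %% m.+1 < m.+1)%N by rewrite ltn_pmod.
rewrite (divn_eq n m.+1) mulnC; apply: (Qr _ (Ordinal lt_r)).
  by rewrite divn_gt0.
by apply: IH; rewrite ltn_Pdiv // (leq_trans _ len).
Qed.

End CantorInt.

(** * Attained minima and maxima *)

Section BigMinMax.
Variables (d : Order.disp_t) (T : orderType d) (I : eqType).
Variables (s : seq I) (F : I -> T) (i0 : I).
Hypothesis s_i0 : i0 \in s.

Lemma bigmin_attained :
  exists2 i, i \in s & \big[Order.min/F i0]_(j <- s) F j = F i.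
Proof.
rewrite big_seq; elim/big_ind: _ => [|_ _ [i si ->] [j sj ->]|i si].
- by exists i0.
- by rewrite minEle; case: ifP => _; [exists i | exists j].
- by exists i.
Qed.

Lemma bigmax_attained :
  exists2 i, i \in s & \big[Order.max/F i0]_(j <- s) F j = F i.
Proof.
rewrite big_seq; elim/big_ind: _ => [|_ _ [i si ->] [j sj ->]|i si].
- by exists i0.
- by rewrite maxEle; case: ifP => _; [exists j | exists i].
- by exists i.
Qed.

End BigMinMax.

(** * Real powers *)

Section PowerFacts.
Variable R : realType.
Implicit Types x y s a : R.

(** Write z^a = z * z^(a-1) and bound z^(a-1) by (x + y)^(a-1), for z = x and z = y. *)
Lemma powR_superadditive x y a : 0 <= x -> 0 <= y -> 1 <= a ->
  x `^ a + y `^ a <= (x + y) `^ a.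
Proof.
move=> x0 y0 a1; have a0 : 0 < a by lra.
have le_part z : 0 <= z -> z <= x + y -> z `^ a <= z * (x + y) `^ (a - 1).
  move=> z0 zxy; rewrite -mulr_powRB1 // ler_wpM2l //.
  by apply: ge0_ler_powR; rewrite ?nnegrE; lra.
rewrite -[leRHS]mulr_powRB1 ?addr_ge0 // mulrDl.
by apply: lerD; apply: le_part; lra.
Qed.

(** After division by x^a this is x^(-a) >= 1 + a (1 - x), which follows from exp y >= 1 + y and ln
    x <= x - 1. *)
Lemma powR_tangent x a : 0 < x -> 0 <= a ->
  a * (1 - x) * x `^ a <= 1 - x `^ a.
Proof.
move=> x0 a0; suff : x `^ a * (1 + a * (1 - x)) <= 1 by lra.
have E : x `^ a * x `^ (- a) = 1 by rewrite powRN divff // gt_eqF ?powR_gt0.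
rewrite -[leRHS]E ler_wpM2l ?powR_ge0 // {E}/powR gt_eqF //.
apply: (le_trans _ (expR_ge1Dx _)); rewrite lerD2l mulNr -mulrN ler_wpM2l //.
have := @le_ln1Dx R (x - 1); rewrite addrCA subrr addr0.
have : -1 < x - 1 by lra.
by move=> x1 /(_ x1); lra.
Qed.

Lemma powR_le_quadratic x a : 0 < x <= 1 -> 4 / 3 <= a ->
  x `^ a <= x * (2 + x) / 3.
Proof.
move=> /andP[x0 x1] a43; apply: (@le_trans _ _ (x `^ (1 + 3^-1))).
  by rewrite ger_powR ?x0 //; lra.
rewrite powRD; last by rewrite (gt_eqF x0) implybT.
rewrite powRr1 ?(ltW x0) // -mulrA ler_wpM2l ?(ltW x0) //.
set w := x `^ 3^-1; have w0 : 0 < w by rewrite powR_gt0.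
have -> : x = w ^+ 3.
  by rewrite -powR_mulrn ?powR_ge0 // -powRrM mulVf ?pnatr_eq0 // powRr1 // ltW.
(* With x = w^3 the claim is 3 w <= 2 + w^3, and the difference factors in this way. *)
have : 0 <= (w - 1) ^+ 2 * (w + 2) by rewrite mulr_ge0 ?sqr_ge0 //; lra.
by rewrite !exprS expr0; lra.
Qed.

Lemma onem_powR_ge x a : 0 <= x < 1 -> 4 / 3 <= a ->
  x * (4 - x) / 3 <= 1 - (1 - x) `^ a.
Proof.
move=> /andP[x0 x1] a43; have x01 : 0 < 1 - x <= 1 by lra.
by have := powR_le_quadratic x01 a43; lra.
Qed.

Lemma powR_convex l x y a : 0 <= l <= 1 -> 0 <= x -> 0 <= y -> 1 <= a ->
  (l * x + (1 - l) * y) `^ a <= l * x `^ a + (1 - l) * y `^ a.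
Proof.
move=> /andP[l0 l1] x0 y0 a1.
have := @convex_powR R a a1 (Itv01 l0 l1) x y.
rewrite !inE /= !in_itv /= !andbT => /(_ x0 y0).
by rewrite [X in X `^ _ <= _ -> _]convRE [X in _ <= X -> _]convRE.
Qed.

(** Both x + t and y are convex combinations of x and y + t, with exchanged weights; the sum of the
    two convexity inequalities is the claim. *)
Lemma powR_increment x y t a : 0 <= x <= y -> 0 <= t -> 1 <= a ->
  (x + t) `^ a - x `^ a <= (y + t) `^ a - y `^ a.
Proof.
move=> /andP[x0 xy] t0 a1.
have [->|t_neq0] := eqVneq t 0; first by rewrite !addr0 !subrr.
have t_gt0 : 0 < t by rewrite lt_def t_neq0.
have w0 : 0 < y - x + t by lra.
set l := t / (y - x + t).
have lw : l * (y - x + t) = t by rewrite divfK // gt_eqF.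
have l01 : 0 <= l <= 1.
  by rewrite /l divr_ge0 ?(ltW w0) //= ler_pdivrMr ?mul1r; lra.
have l01' : 0 <= 1 - l <= 1 by lra.
have yt0 : 0 <= y + t by lra.
have /= := powR_convex l01 yt0 x0 a1.
have /= := powR_convex l01' yt0 x0 a1.
have -> : (1 - l) * (y + t) + (1 - (1 - l)) * x = y by lra.
have -> : l * (y + t) + (1 - l) * x = x + t by lra.
lra.
Qed.

End PowerFacts.

(** * Polynomial inequalities *)

Section QuadraticInequalities.
Variable R : realFieldType.
Implicit Types m a c s S P : R.

(** [S] stands for the largest value of a (m - 1 + e) + c, at e = m - 1. After lowering [c] to 2 and
    setting m = 2 + k, S = 2 m + s, the differences of the two sides have nonnegative coefficients
    in [k] and [s]. *)
Lemma quad_slope_large c m S P : 2 <= m -> 2 <= c -> 2 * m <= S ->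
  P = m / 2 * (S + c) + 1 ->
  2 * (m + 1) ^+ 2 * S <= (P * c + 1 + c * m) * P /\ (m + 1) ^+ 2 * S <= P ^+ 2.
Proof.
move=> m2 c2 S2m PE; set P0 := m / 2 * (S + 2) + 1.
have leP : P0 <= P by rewrite PE /P0; nra.
have P0_gt0 : 0 <= P0 by rewrite /P0; nra.
have le_c : 2 * P0 + 1 + 2 * m <= P * c + 1 + c * m by nra.
have [k [s [k0 s0 mE SE]]] : exists k s, [/\ 0 <= k, 0 <= s, m = 2 + k & S = 2 * (2 + k) + s].
  by exists (m - 2), (S - 2 * m); split; lra.
have k2 : 0 <= k ^+ 2 by apply: sqr_ge0.
have k3 : 0 <= k ^+ 3 by rewrite exprn_ge0.
have k4 : 0 <= k ^+ 4 by rewrite exprn_ge0.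
have ks : 0 <= k * s by rewrite mulr_ge0.
have k2s : 0 <= k ^+ 2 * s by rewrite mulr_ge0.
have k3s : 0 <= k ^+ 3 * s by rewrite mulr_ge0.
have s2 : 0 <= s ^+ 2 by apply: sqr_ge0.
have ks2 : 0 <= k * s ^+ 2 by rewrite mulr_ge0.
have k2s2 : 0 <= k ^+ 2 * s ^+ 2 by rewrite mulr_ge0.
split.
  apply: (@le_trans _ _ ((2 * P0 + 1 + 2 * m) * P0)); last by apply: ler_pM => //; nra.
  by rewrite /P0 SE mE; lra.
apply: (@le_trans _ _ (P0 ^+ 2)); last by rewrite ler_sqr ?nnegrE ?(le_trans P0_gt0).
by rewrite /P0 SE mE; lra.
Qed.

Lemma quad_slope_one m S P : 3 <= m -> 2 * m - 1 <= S ->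
  P = m / 2 * (S + 1) + 1 ->
  96 * (m + 1) ^+ 2 * S <= 61 * (P + 1 + m) * P /\
  48 * (m + 1) ^+ 2 * S <= 61 * P ^+ 2.
Proof.
move=> m3 Sm ->.
have [k [s [k0 s0 -> ->]]] :
    exists k s, [/\ 0 <= k, 0 <= s, m = 3 + k & S = 2 * (3 + k) - 1 + s].
  by exists (m - 3), (S - (2 * m - 1)); split; lra.
have k2 : 0 <= k ^+ 2 by apply: sqr_ge0.
have k3 : 0 <= k ^+ 3 by rewrite exprn_ge0.
have k4 : 0 <= k ^+ 4 by rewrite exprn_ge0.
have ks : 0 <= k * s by rewrite mulr_ge0.
have k2s : 0 <= k ^+ 2 * s by rewrite mulr_ge0.
have k3s : 0 <= k ^+ 3 * s by rewrite mulr_ge0.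
have s2 : 0 <= s ^+ 2 by apply: sqr_ge0.
have ks2 : 0 <= k * s ^+ 2 by rewrite mulr_ge0.
have k2s2 : 0 <= k ^+ 2 * s ^+ 2 by rewrite mulr_ge0.
by split; lra.
Qed.

(* [A] and [N] stand for [C n + 1] and [n + 1], [P] for the new base and [t] for
   the relative decrease of [n + 1] caused by the last digit [e]. *)
Lemma quad_step_generic m a c e P A N t :
  2 <= m -> 1 <= a -> 0 <= e -> e + 1 <= m -> 0 <= t <= 1 ->
  t * ((m + 1) * (m + 1)) <= m -> m + 1 <= N -> 0 <= A -> 0 <= P ->
  P = a * (m * (m - 1)) + c * m + 1 -> 3 <= m /\ c = 1 \/ 2 <= c ->
  (A = P /\ N = m + 1) \/ (P * c + 1 + c * m) * N <= 2 * (m + 1) * A ->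
  3 * ((m + 1) * N) * (a * (m - 1 + e) + c) <= A * P * (4 - t).
Proof.
move=> m2 a1 e0 em /andP[t0 t1] tm Nm A0 P0 PE mc AN.
set S := a * (2 * m - 2) + c; have am : 0 <= (a - 1) * (2 * m - 2).
  by rewrite mulr_ge0; lra.
have PS : P = m / 2 * (S + c) + 1 by rewrite PE /S; lra.
have N0 : 0 <= N by lra.
have le_S : (m + 1) * N * (a * (m - 1 + e) + c) <= (m + 1) * N * S.
  by rewrite ler_wpM2l ?mulr_ge0 ?lerD2r ?ler_wpM2l //; lra.
have [k [k0 k4 kP kPc]] : exists k, [/\ 0 <= k, 3 * k <= 4 - t,
    (m + 1) ^+ 2 * S <= k * P ^+ 2 &
    2 * (m + 1) ^+ 2 * S <= k * ((P * c + 1 + c * m) * P)].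
  case: mc => [[m3 c1]|c2].
    rewrite c1 in PS PE *; have Sm : 2 * m - 1 <= S by rewrite /S c1; lra.
    have [h1 h2] := quad_slope_one m3 Sm PS.
    (* Here 61/48 = (4 - 3/16) / 3, and t <= m / (m + 1)^2 <= 3/16 for m >= 3. *)
    exists (61 / 48); split; [lra| |lra|lra].
    suff : t <= 3 / 16 by lra.
    have m16 : 0 < (m + 1) * (m + 1) by rewrite mulr_gt0; lra.
    rewrite -(ler_pM2r m16); apply: le_trans tm _.
    have : 0 <= (3 * m - 1) * (m - 3) by rewrite mulr_ge0; lra.
    lra.
  have Sm : 2 * m <= S by rewrite /S; lra.
  have [h1 h2] := quad_slope_large m2 c2 Sm PS.
  by exists 1; split; rewrite ?mul1r //; lra.
have key : (m + 1) * N * S <= k * (A * P).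
  case: AN => [[-> ->]|grow]; first by lra.
  have m1 : 0 < 2 * (m + 1) by lra.
  have h1 : N * (2 * (m + 1) ^+ 2 * S) <= N * (k * ((P * c + 1 + c * m) * P)).
    by rewrite ler_wpM2l.
  have h2 : (k * P) * ((P * c + 1 + c * m) * N) <= (k * P) * (2 * (m + 1) * A).
    by rewrite ler_wpM2l // mulr_ge0.
  rewrite -(ler_pM2l m1).
  have -> : 2 * (m + 1) * ((m + 1) * N * S) = N * (2 * (m + 1) ^+ 2 * S) by ring.
  apply: le_trans h1 _.
  have -> : N * (k * ((P * c + 1 + c * m) * P)) = k * P * ((P * c + 1 + c * m) * N).
    by ring.
  apply: le_trans h2 _.
  by rewrite le_eqVlt; apply/orP; left; apply/eqP; ring.
have : (3 * k) * (A * P) <= (4 - t) * (A * P) by rewrite ler_wpM2r // mulr_ge0.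
lra.
Qed.

(** The remaining case m = 2, c = 1. As 4 - t >= (34 + e) / 9, it suffices to compare two affine
    functions of [e] at e = 0 and e = 1, whence the constants 34 and 35. *)
Lemma quad_step_two a e P A N t :
  1 <= a -> 0 <= e -> e + 1 <= 2 -> 0 <= t <= 1 ->
  t * ((2 + 1) * (2 + 1)) <= 2 - e -> 2 + 1 <= N -> 0 <= A -> 0 <= P ->
  P = a * (2 * (2 - 1)) + 1 * 2 + 1 ->
  (A = P /\ N = 2 + 1) \/ (P + 2) * N <= 5 * A ->
  3 * ((2 + 1) * N) * (a * (2 - 1 + e) + 1) <= A * P * (4 - t).
Proof.
move=> a1 e0 e1 /andP[t0 t1] te N3 A0 P0 PE AN.
have {}PE : P = 2 * a + 3 by lra.
have aa : 0 <= (a - 1) * (a - 1) by rewrite mulr_ge0; lra.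
have [h0 h1] : 81 * N * (a + 1) <= 34 * (A * P) /\
               81 * N * (2 * a + 1) <= 35 * (A * P).
  case: AN => [[-> ->]|grow]; first by rewrite PE; split; lra.
  have : (P + 2) * N * P <= 5 * A * P by rewrite ler_wpM2r.
  have : 0 <= N * ((a - 1) * (a - 1)) by rewrite mulr_ge0; lra.
  have : 0 <= N * (a - 1) by rewrite mulr_ge0; lra.
  by rewrite PE; split; lra.
have : 0 <= (1 - e) * (34 * (A * P) - 81 * N * (a + 1)) by rewrite mulr_ge0; lra.
have : 0 <= e * (35 * (A * P) - 81 * N * (2 * a + 1)) by rewrite mulr_ge0; lra.
have : 0 <= (A * P) * (2 - e - t * ((2 + 1) * (2 + 1))).
  by rewrite !mulr_ge0 //; lra.
lra.
Qed.

(** In al (c + r) = al (a + c) - al (a - r) the slope hypothesis bounds the first term and al >= 2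
    the second; what is left is (c - a) s - 2 r. *)
Lemma slope_at_one_large_c a c s r al :
  1 <= a -> a + 2 <= c -> 0 <= s <= 1 -> 0 <= r <= s -> 2 <= al ->
  0 < 2 * a * (1 + s) - (al - 1) * (a + c) ->
  0 <= (a + c) * (1 + s) - al * (c + r).
Proof.
move=> a1 ac /andP[s0 s1] /andP[r0 rs] al2 pos.
have : 0 <= (a - r) * (al - 2) by rewrite mulr_ge0; lra.
have : 0 <= (c - a - 2) * s by rewrite mulr_ge0; lra.
lra.
Qed.

(** The conclusion times a + c: the slope hypothesis eliminates [al], then r <= s^2 eliminates [r],
    and the cubic inequality in [s] remains. *)
Lemma slope_at_one_cubic a c s r al : 1 <= a -> 1 <= c -> 0 <= s -> 0 <= r ->
  r <= s ^+ 2 -> 0 < 2 * a * (1 + s) - (al - 1) * (a + c) ->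
  2 * a * s ^+ 3 + s ^+ 2 * (3 * a + c) <= (a ^+ 2 + c ^+ 2) * s + a * (a - c) ->
  0 <= (a + c) * (1 + s) - al * (c + r).
Proof.
move=> a1 c1 s0 r0 rs pos cubic.
suff : 0 <= (a + c) * ((a + c) * (1 + s) - al * (c + r)) by rewrite pmulr_rge0 //; lra.
have : 0 <= (2 * a * (1 + s) - (al - 1) * (a + c)) * (c + r) by rewrite mulr_ge0; lra.
have as0 : 0 <= a * s by rewrite mulr_ge0; lra.
have : 0 <= (a + c + 2 * a * (1 + s)) * (s ^+ 2 - r) by rewrite mulr_ge0; lra.
lra.
Qed.

(** The right side minus the left is concave in [s] on [0, 1], nonnegative at 0 because c <= a, and
    at 1 by the last hypothesis. *)
Lemma slope_cubic_le a c s : 1 <= a -> c <= a -> 1 <= c -> 0 <= s <= 1 ->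
  a * c + 5 * a + c <= 2 * a ^+ 2 + c ^+ 2 ->
  2 * a * s ^+ 3 + s ^+ 2 * (3 * a + c) <= (a ^+ 2 + c ^+ 2) * s + a * (a - c).
Proof.
move=> a1 ca c1 /andP[s0 s1] G1.
have sE : 0 <= s * (1 - s) by rewrite mulr_ge0; lra.
have sE2 : 0 <= s ^+ 2 * (1 - s) by rewrite mulr_ge0 ?sqr_ge0; lra.
have ac0 : 0 <= a * (a - c) by rewrite mulr_ge0; lra.
have : 0 <= (1 - s) * (a * (a - c)) by rewrite mulr_ge0; lra.
have : 0 <= s * (2 * a ^+ 2 + c ^+ 2 - (a * c + 5 * a + c)) by rewrite mulr_ge0; lra.
have : 0 <= (3 * a + c) * (s * (1 - s)) by rewrite mulr_ge0; lra.
have : 0 <= a * (s * (1 - s)) by rewrite mulr_ge0; lra.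
have : 0 <= a * (s ^+ 2 * (1 - s)) by rewrite mulr_ge0; lra.
lra.
Qed.

(** The case c = a + 1, where the inequality fails at s = 0. A positive slope together with al >= 2
    forces 1 <= 2 a s. *)
Lemma slope_cubic_succ a s : 3 <= a -> s <= 1 -> 1 <= 2 * a * s ->
  2 * a * s ^+ 3 + s ^+ 2 * (3 * a + (a + 1))
    <= (a ^+ 2 + (a + 1) ^+ 2) * s + a * (a - (a + 1)).
Proof.
move=> a3 s1 sA; have s0 : 0 <= s by nra.
have sB : 0 <= (2 * a * s - 1) * (1 - s) by rewrite mulr_ge0; lra.
have : 0 <= (2 * a * s - 1) * (1 - s) * s by rewrite mulr_ge0.
have : 0 <= (2 * a * s - 1) * (a - 23 / 9) by rewrite mulr_ge0; lra.
have : 0 <= s * (a - 3) by rewrite mulr_ge0; lra.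
have : 0 <= s ^+ 2 * (a - 3) by rewrite mulr_ge0 ?sqr_ge0; lra.
lra.
Qed.

Lemma slope_at_one_2_1 s r al : 0 <= s <= 1 -> 0 <= r <= s ^+ 2 -> al <= 3 ->
  0 <= (2 + 1) * (1 + s) - al * (1 + r).
Proof.
move=> /andP[s0 s1] /andP[r0 rs] al3.
have : 0 <= (3 - al) * (1 + r) by rewrite mulr_ge0; lra.
have : 0 <= s * (1 - s) by rewrite mulr_ge0; lra.
lra.
Qed.

Lemma slope_at_one_3_2 s r al : 0 <= s <= 1 -> 0 <= r <= s ^+ 2 -> al <= 5 / 2 ->
  0 <= (3 + 2) * (1 + s) - al * (2 + r).
Proof.
move=> /andP[s0 s1] /andP[r0 rs] al52.
have : 0 <= (5 / 2 - al) * (2 + r) by rewrite mulr_ge0; lra.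
have : 0 <= s * (1 - s) by rewrite mulr_ge0; lra.
lra.
Qed.

(** The slope hypothesis reads al < 2 + s; it and al <= 5/2 cross at s = 1/2. *)
Lemma slope_at_one_2_2 s r al : 0 <= s <= 1 -> 0 <= r <= s ^+ 2 ->
  2 <= al <= 5 / 2 -> 0 < 2 * 2 * (1 + s) - (al - 1) * (2 + 2) ->
  0 <= (2 + 2) * (1 + s) - al * (2 + r).
Proof.
move=> /andP[s0 s1] /andP[r0 rs] /andP[al2 al52] pos.
have : 0 <= al * (s ^+ 2 - r) by rewrite mulr_ge0; lra.
have [s_small|s_large] := leP s (1 / 2).
  have : 0 <= (2 + s - al) * (2 + s ^+ 2) by rewrite mulr_ge0; lra.
  have : 0 <= s * (1 / 2 - s) by rewrite mulr_ge0; lra.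
  have : 0 <= s ^+ 2 * (1 / 2 - s) by rewrite mulr_ge0 ?sqr_ge0; lra.
  lra.
have : 0 <= (5 / 2 - al) * (2 + s ^+ 2) by rewrite mulr_ge0; lra.
have : 0 <= (s - 1 / 2) * (1 - s) by rewrite mulr_ge0; lra.
lra.
Qed.

(** The slope hypothesis reads al < (9 + 4 s) / 5, so al >= 2 gives s > 1/4. It is used up to s =
    3/5, and al <= 7/3 beyond. *)
Lemma slope_at_one_2_3 s r al : 0 <= s <= 1 -> 0 <= r <= s ^+ 2 ->
  2 <= al <= 7 / 3 -> 0 < 2 * 2 * (1 + s) - (al - 1) * (2 + 3) ->
  0 <= (2 + 3) * (1 + s) - al * (3 + r).
Proof.
move=> /andP[s0 s1] /andP[r0 rs] /andP[al2 al73] pos.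
have : 0 <= al * (s ^+ 2 - r) by rewrite mulr_ge0; lra.
have [s_small|s_large] := leP s (3 / 5).
  have : 0 <= ((9 + 4 * s) / 5 - al) * (3 + s ^+ 2) by rewrite mulr_ge0; lra.
  have s_ge : 0 <= (s - 1 / 4) * (3 / 5 - s) by rewrite mulr_ge0; lra.
  have : 0 <= (s - 1 / 4) * (3 / 5 - s) * s by rewrite mulr_ge0.
  lra.
have : 0 <= (7 / 3 - al) * (3 + s ^+ 2) by rewrite mulr_ge0; lra.
have : 0 <= (s - 3 / 5) * (1 - s) by rewrite mulr_ge0; lra.
lra.
Qed.

(** This supplies the endpoint condition at s = 1 of [slope_cubic_le]; for the excluded pair it
    would read 23 <= 22. *)
Lemma slope_cubic_coeff (a c : nat) : (3 <= a)%N -> (0 < c)%N -> (c <= a)%N ->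
  ~~ ((a == 3) && (c == 2))%N ->
  (a * c + 5 * a + c <= 2 * a ^ 2 + c ^ 2)%N.
Proof.
move=> a3 c0 le_ca not32; have [k aE] : exists k, a = (c + k)%N by exists (a - c)%N; lia.
subst a; case: c c0 a3 le_ca not32 => [|[|[|c]]] // _ a3 le_ca not32.
- case: k a3 le_ca not32 => [|[|k]] // _ _ _; rewrite !expnS !expn0; nia.
- case: k a3 le_ca not32 => [|[|k]] // _ _ _; rewrite !expnS !expn0; nia.
- rewrite !expnS !expn0; nia.
Qed.

(* For [h u = (a * u ^+ 2 + (c - a) * u + r) / (u + s) `^ al] the product of the
   derivative [h' u] and [(u + s) `^ (al + 1)] is a quadratic polynomial in [u];
   the last hypothesis says that its slope at [u = 1] is positive, the conclusion
   that its value there is nonnegative.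
   The four pairs [(a, c)] with a bound on [al] are those for which the cubic
   inequality of [slope_at_one_cubic] fails near [s = 1]. *)
Lemma slope_at_one (a c : nat) s r al :
  (0 < a)%N -> (0 < c)%N -> 0 <= s <= 1 -> 0 <= r <= s -> 2 <= al ->
  ((c <= a.+1)%N -> r <= s ^+ 2) -> (a = 1 -> 3 <= c)%N ->
  (a = 2%N -> c = 1%N -> al <= 3) -> (a = 2%N -> c = 2%N -> al <= 5 / 2) ->
  (a = 2%N -> c = 3%N -> al <= 7 / 3) -> (a = 3%N -> c = 2%N -> al <= 5 / 2) ->
  0 < 2 * a%:R * (1 + s) - (al - 1) * (a%:R + c%:R) ->
  0 <= (a%:R + c%:R) * (1 + s) - al * (c%:R + r).
Proof.
move=> a1 c1 s01 r0s al2 r_le a_ne1 e21 e22 e23 e32.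
have a1R : 1 <= a%:R :> R by rewrite ler1n.
have c1R : 1 <= c%:R :> R by rewrite ler1n.
have [le_ca|lt_ac] := leqP c a.+1; last first.
  by apply: slope_at_one_large_c; rewrite // -natrD ler_nat addn2.
have r_s2 : 0 <= r <= s ^+ 2 by case/andP: r0s => -> _; exact: r_le.
have [a_lt3|a3] := ltnP a 3.
  case: a a1 a_lt3 {a1R} le_ca a_ne1 e21 e22 e23 e32 r_le => [|[|[|a]]] // _ _ le_ca a_ne1 e21 e22 e23 _ _.
    by have := a_ne1 erefl; rewrite leqNgt ltnS le_ca.
  case: c c1 {c1R} le_ca e21 e22 e23 {a_ne1} => [|[|[|[|c]]]] // _ _ e21 e22 e23 pos.
  - exact: slope_at_one_2_1 (e21 erefl erefl).
  - by apply: slope_at_one_2_2 => //; rewrite al2 e22.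
  - by apply: slope_at_one_2_3 => //; rewrite al2 e23.
have [/andP[/eqP aE /eqP cE]|not32] := boolP ((a == 3) && (c == 2))%N.
  by move=> _; rewrite aE cE; apply: slope_at_one_3_2 => //; exact: e32.
have [s0 s1] := andP s01; have [r0 rs2] := andP r_s2.
move=> pos; apply: slope_at_one_cubic => //.
have [le_ca'|lt_ac] := leqP c a.
  apply: slope_cubic_le => //; first by rewrite ler_nat.
  by have := slope_cubic_coeff a3 c1 le_ca' not32; rewrite -(ler_nat R) !natrD !natrM; lra.
have cE : c%:R = a%:R + 1 :> R by rewrite natr1; congr (_%:R); apply/eqP; rewrite eqn_leq le_ca.
rewrite cE in pos *; apply: slope_cubic_succ => //; first by rewrite ler_nat.
have : 0 <= (al - 2) * (2 * a%:R + 1) by rewrite mulr_ge0; lra.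
lra.
Qed.

End QuadraticInequalities.

(** * Comparison of trailing and leading digits *)

Section TrailingDigit.
Variable R : realFieldType.
Implicit Types m a c v u r s P : R.

(** This is r <= s for r = (f v + 1) / P and s = (v + 1) / q, with denominators cleared. Equality at
    v = m yields the factor m - v. *)
Lemma trailing_le m a c v P : 1 <= m -> 0 <= a -> 1 <= c -> 0 <= v <= m ->
  P = a * (m * (m - 1)) + c * m + 1 ->
  (a * (v * (v - 1)) + c * v + 1) * (m + 1) <= (v + 1) * P.
Proof.
move=> m1 a0 c1 /andP[v0 vm] ->; rewrite -subr_ge0.
have -> : (v + 1) * (a * (m * (m - 1)) + c * m + 1) -
    (a * (v * (v - 1)) + c * v + 1) * (m + 1) =
    (m - v) * (a * (v * m + (m - 1) + v) + (c - 1)) by ring.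
have vm0 : 0 <= v * m by rewrite mulr_ge0; lra.
have : 0 <= a * (v * m + (m - 1) + v) by rewrite mulr_ge0; lra.
by move=> av; rewrite mulr_ge0; lra.
Qed.

Lemma trailing_le_sqr m a c v P : 1 <= m -> 1 <= a -> c <= a + 1 -> 0 <= v <= m ->
  P = a * (m * (m - 1)) + c * m + 1 -> (m + 1) ^+ 2 <= P ->
  (a * (v * (v - 1)) + c * v + 1) * (m + 1) ^+ 2 <= (v + 1) ^+ 2 * P.
Proof.
move=> m1 a1 ca /andP[v0 vm] PE; rewrite {1}PE => le_P; rewrite PE -subr_ge0.
set b := c - a.
have -> : (v + 1) ^+ 2 * (a * (m * (m - 1)) + c * m + 1) -
    (a * (v * (v - 1)) + c * v + 1) * (m + 1) ^+ 2 =
    (m - v) * (v * ((2 * a - b) * m + (a - 1)) + (a * m + b - m - 2)).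
  by rewrite /b; ring.
(* Multiplied by [m] this is P - (m + 1)^2. *)
have amb : 0 <= a * m + b - m - 2.
  rewrite -(pmulr_rge0 _ (_ : 0 < m)); last by lra.
  by rewrite /b; lra.
have abm : 0 <= (2 * a - b) * m by rewrite mulr_ge0 /b; lra.
have : 0 <= v * ((2 * a - b) * m + (a - 1)) by rewrite mulr_ge0; lra.
by move=> vb; rewrite mulr_ge0; lra.
Qed.

Lemma square_leading_le u r s : 1 <= u -> 0 <= s -> r <= s ->
  (1 + r) * (u + s) ^+ 2 <= (u ^+ 2 + r) * (1 + s) ^+ 2.
Proof.
move=> u1 s0 rs; rewrite -subr_ge0.
have -> : (u ^+ 2 + r) * (1 + s) ^+ 2 - (1 + r) * (u + s) ^+ 2 =
    (u - 1) * (s * (u - 1) + s ^+ 2 * (u - 1) + (s - r) * (u + 1 + 2 * s)) by ring.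
have s2 : 0 <= s ^+ 2 by apply: sqr_ge0.
have : 0 <= s * (u - 1) by rewrite mulr_ge0; lra.
have : 0 <= s ^+ 2 * (u - 1) by rewrite mulr_ge0; lra.
have : 0 <= (s - r) * (u + 1 + 2 * s) by rewrite mulr_ge0; lra.
by move=> *; rewrite mulr_ge0; lra.
Qed.

(** For f = x^2 + x: comparison with leading digit 1 and trailing digit [m], where f 1 + r = 3 and 1
    + s = 2. *)
Lemma pronic_leading_le u r s : 2 <= u -> 0 <= s <= 1 -> 3 / 4 * s ^+ 2 <= r ->
  3 * (u + s) ^+ 2 <= (u ^+ 2 + u + r) * 2 ^+ 2.
Proof.
move=> u2 /andP[s0 s1] rs.
have : 0 <= u * (u - 2) by rewrite mulr_ge0; lra.
have : 0 <= u * (1 - s) by rewrite mulr_ge0; lra.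
lra.
Qed.

(** The constant 3/4 is the minimum of (v^2 + v + 1) / (v + 1)^2, at v = 1; moreover P <= (m +
    1)^2. *)
Lemma pronic_trailing_ge m v P : 0 <= m -> P = m ^+ 2 + m + 1 ->
  3 / 4 * (v + 1) ^+ 2 * P <= (v ^+ 2 + v + 1) * (m + 1) ^+ 2.
Proof.
move=> m0 ->; have v2 : 0 <= (v - 1) ^+ 2 by apply: sqr_ge0.
have m1 : 0 <= m ^+ 2 + m + 1 by rewrite !addr_ge0 ?sqr_ge0.
apply: (@le_trans _ _ ((v ^+ 2 + v + 1) * (m ^+ 2 + m + 1))).
  by rewrite ler_wpM2r //; lra.
have v3 : 0 <= (2 * v + 1) ^+ 2 by apply: sqr_ge0.
by rewrite ler_wpM2l; lra.
Qed.

(** An inequality P^j <= q^i means alpha <= i/j; these are the bounds on alpha that [slope_at_one]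
    requires for (a, c) = (2, 1), (2, 2), (2, 3) and (3, 2). *)
Lemma exceptional_bases m P : 3 <= m ->
  [/\ P = 2 * (m * (m - 1)) + 1 * m + 1 -> P ^+ 1 <= (m + 1) ^+ 3,
      P = 2 * (m * (m - 1)) + 2 * m + 1 -> P ^+ 2 <= (m + 1) ^+ 5,
      P = 2 * (m * (m - 1)) + 3 * m + 1 -> P ^+ 3 <= (m + 1) ^+ 7 &
      P = 3 * (m * (m - 1)) + 2 * m + 1 -> P ^+ 2 <= (m + 1) ^+ 5].
Proof.
move=> m3; have [k k0 ->] : exists2 k, 0 <= k & m = 3 + k by exists (m - 3); lra.
have k2 : 0 <= k ^+ 2 by rewrite exprn_ge0.
have k3 : 0 <= k ^+ 3 by rewrite exprn_ge0.
have k4 : 0 <= k ^+ 4 by rewrite exprn_ge0.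
have k5 : 0 <= k ^+ 5 by rewrite exprn_ge0.
have k6 : 0 <= k ^+ 6 by rewrite exprn_ge0.
have k7 : 0 <= k ^+ 7 by rewrite exprn_ge0.
by split=> ->; lra.
Qed.

Lemma base_lt_sqr (a c : nat) m P : (0 < a)%N -> (0 < c)%N -> 3 <= m ->
  P = a%:R * (m * (m - 1)) + c%:R * m + 1 -> P < (m + 1) ^+ 2 ->
  a = 1%N /\ (c = 1%N \/ c = 2%N).
Proof.
move=> a0 c0 m3 PE lt_P.
have c1 : 1 <= c%:R :> R by rewrite ler1n.
have aE : a = 1%N.
  apply/eqP; rewrite eqn_leq a0 andbT leqNgt; apply/negP => a2.
  have a2R : 2 <= a%:R :> R by rewrite ler_nat.
  have m0 : 0 <= m * (m - 1) by rewrite mulr_ge0; lra.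
  have : 0 <= (a%:R - 2) * (m * (m - 1)) by rewrite mulr_ge0 //; lra.
  have : 0 <= (c%:R - 1) * m by rewrite mulr_ge0; lra.
  have : 0 <= m * (m - 3) by rewrite mulr_ge0; lra.
  by move: lt_P; rewrite PE; lra.
split=> //; have c2 : (c <= 2)%N.
  rewrite leqNgt; apply/negP => c3; have c3R : 3 <= c%:R :> R by rewrite ler_nat.
  have : 0 <= (c%:R - 3) * m by rewrite mulr_ge0; lra.
  by move: lt_P; rewrite PE aE; lra.
by case: c c0 c2 {c1 PE} => [|[|[|c]]] // _ _; [left | right].
Qed.

End TrailingDigit.

Lemma powR_pred (R : realType) (x e : R) : 0 < x -> x `^ e = x * x `^ (e - 1).
Proof.
move=> x0; have cond : (e - 1 + 1 == 0) ==> (x != 0) by rewrite (gt_eqF x0) implybT.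
by have := powRD cond; rewrite subrK powRr1 ?(ltW x0) // mulrC.
Qed.

(** * Variation of a quadratic divided by a power *)

Section QuadraticOverPower.
Variables (R : realType) (a b r s al : R).
Hypothesis s0 : 0 <= s.

Let h (u : R) := (a * u ^+ 2 + b * u + r) * (u + s) `^ (- al).
Let slope (u : R) := (2 * a * u + b) * (u + s) - al * (a * u ^+ 2 + b * u + r).

Lemma is_derive_quad_powR (u : R) : 0 < u ->
  is_derive u 1 h (slope u * (u + s) `^ (- al - 1)).
Proof.
move=> u0; have us0 : 0 < u + s by apply: ltr_wpDr.
have dshift : is_derive u 1 (fun x : R => x + s) 1.
  by apply: is_derive_eq; rewrite addr0.
have pow : is_derive u 1 (fun x : R => (x + s) `^ (- al))
                      (- al * (u + s) `^ (- al - 1)).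
  have := is_derive1_comp (f := @powR R ^~ (- al)) (g := fun x : R => x + s) (x := u)
    (is_derive1_powR _ us0) dshift.
  by rewrite mulr1.
have quad : is_derive u 1 (fun x : R => a * x ^+ 2 + b * x + r) (2 * a * u + b).
  apply: is_derive_eq.
  rewrite /GRing.scale /=. 
  by ring.
apply: (is_derive_eq (is_deriveM quad pow)).
rewrite /GRing.scale /= /slope.
rewrite (powR_pred (- al) us0); move: (_ `^ (- al - 1)) => w.
by ring.
Qed.

Let h_homo (x y : R) : 0 < x -> x <= y ->
  (forall z, x <= z <= y -> 0 <= slope z) -> h x <= h y.
Proof.
move=> x0 xy slope0; have z0 z : x <= z -> 0 < z by apply: lt_le_trans.
apply: (@ger0_derive1_le_cc _ h x y); rewrite ?in_itv /= ?lexx ?xy //.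
- by move=> z /[!in_itv] /= /andP[xz _]; have [] := is_derive_quad_powR (z0 z (ltW xz)).
- move=> z /[!in_itv] /= /andP[xz zy].
  have := is_derive_quad_powR (z0 z (ltW xz)).
  rewrite derive1E => /@derive_val ->.
  by rewrite mulr_ge0 ?powR_ge0 // slope0 // !ltW.
- apply: derivable_within_continuous => z /[!in_itv] /= /andP[xz _].
  by have [] := is_derive_quad_powR (z0 z xz).
Qed.

Let h_nhomo (x y : R) : 0 < x -> x <= y ->
  (forall z, x <= z <= y -> slope z <= 0) -> h y <= h x.
Proof.
move=> x0 xy slope0; have z0 z : x <= z -> 0 < z by apply: lt_le_trans.
apply: (@ler0_derive1_le_cc _ h x y); rewrite ?in_itv /= ?lexx ?xy //.
- by move=> z /[!in_itv] /= /andP[xz _]; have [] := is_derive_quad_powR (z0 z (ltW xz)).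
- move=> z /[!in_itv] /= /andP[xz zy].
  have := is_derive_quad_powR (z0 z (ltW xz)).
  rewrite derive1E => /@derive_val ->.
  by rewrite mulr_le0_ge0 ?powR_ge0 // slope0 // !ltW.
- apply: derivable_within_continuous => z /[!in_itv] /= /andP[xz _].
  by have [] := is_derive_quad_powR (z0 z xz).
Qed.

(* [slope] is concave, so that by the implication assumed it changes sign at
   most once to the right of [1], from positive to negative. *)
Lemma quad_powR_quasiconcave (u w : R) : 0 <= a -> 2 <= al ->
  (0 < 2 * a * (1 + s) - (al - 1) * (2 * a + b) ->
     0 <= (2 * a + b) * (1 + s) - al * (a + b + r)) ->
  1 <= u <= w -> Num.min (h 1) (h w) <= h u.
Proof.
move=> a0 al2 incr1 /andP[u1 uw]; have s_ge0 := s0; have [w1 u0] : 1 <= w /\ 0 < u by split; lra.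
have slope1 : slope 1 = (2 * a + b) * (1 + s) - al * (a + b + r).
  by rewrite /slope; ring.
rewrite ge_min; have [slope1_ge0|slope1_lt0] := leP 0 (slope 1).
  have [slope_u|slope_u] := leP 0 (slope u).
    apply/orP; left; apply: h_homo => // z /andP[z1 zu].
    have [->//|zu_neq] := eqVneq z u; have z_lt : z < u by rewrite lt_neqAle zu_neq.
    have pos : 0 <= a * (al - 2) * ((z - 1) * (u - z) * (u - 1)).
      by rewrite !mulr_ge0; lra.
    have pos1 : 0 <= (u - z) * slope 1 by rewrite mulr_ge0; lra.
    have pos2 : 0 <= (z - 1) * slope u by rewrite mulr_ge0; lra.
    suff : 0 <= (u - 1) * slope z by rewrite pmulr_rge0 //; lra.
    (* Concavity at the points 1, z, u in exact form: [slope] has leading coefficient - a (al -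
       2). *)
    have -> : (u - 1) * slope z = (u - z) * slope 1 + (z - 1) * slope u +
       a * (al - 2) * ((z - 1) * (u - z) * (u - 1)) by rewrite /slope; ring.
    lra.
  apply/orP; right; apply: h_nhomo => // z /andP[uz zw].
  have u_gt1 : 1 < u.
    by rewrite lt_neqAle u1 andbT; apply: contraTneq slope_u => <-; rewrite -leNgt.
  have pos : 0 <= a * (al - 2) * ((u - 1) * (z - u) * (z - 1)).
    by rewrite !mulr_ge0; lra.
  have pos1 : 0 <= (z - u) * slope 1 by rewrite mulr_ge0; lra.
  have neg : (z - 1) * slope u <= 0 by rewrite mulr_ge0_le0; lra.
  have E : (z - 1) * slope u = (z - u) * slope 1 + (u - 1) * slope z +
     a * (al - 2) * ((u - 1) * (z - u) * (z - 1)) by rewrite /slope; ring.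
  have : (u - 1) * slope z <= 0 by lra.
  by rewrite pmulr_rle0 //; lra.
(* By contraposition of [incr1], [slope] is negative and not increasing at 1; by concavity it stays
   negative to the right. *)
have decr1 : 2 * a * (1 + s) - (al - 1) * (2 * a + b) <= 0.
  rewrite leNgt; apply/negP => /incr1; rewrite -slope1; lra.
apply/orP; right; apply: h_nhomo => // z /andP[uz zw].
have -> : slope z = slope 1 + (2 * a * (1 + s) - (al - 1) * (2 * a + b)) * (z - 1)
    - a * (al - 2) * (z - 1) ^+ 2 by rewrite /slope; ring.
have : 0 <= a * (al - 2) * (z - 1) ^+ 2 by rewrite !mulr_ge0 ?sqr_ge0; lra.
have : (2 * a * (1 + s) - (al - 1) * (2 * a + b)) * (z - 1) <= 0.
  by rewrite mulr_le0_ge0; lra.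
lra.
Qed.

End QuadraticOverPower.

(** * Limits along geometric sequences *)

Section GeometricLimits.
Variable R : realType.

Lemma powR_geometric_limit (c x y z a : R) : `|z| < 1 -> 0 < x ->
  (forall k : nat, c * (x - z ^+ k) `^ a <= y) -> c * x `^ a <= y.
Proof.
move=> z1 x0 le_y.
have cvg_x : (x - z ^+ k @[k --> \oo] --> x)%classic.
  rewrite -[X in (_ --> X)%classic]subr0.
  by apply: cvgB; [exact: cvg_cst | exact: cvg_expr].
have cts : {for x, continuous (fun u : R => c * u `^ a)}.
  apply: continuousM; first exact: cvg_cst.
  apply: differentiable_continuous; apply/derivable1_diffP.
  by apply: derivable_powR; rewrite in_itv /= andbT.
by apply: (cvgr_to_le (continuous_cvg _ cts cvg_x)); apply: nearW.
Qed.

Lemma geometric_limit (x y z : R) : `|z| < 1 ->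
  (forall k : nat, x <= y + z ^+ k) -> x <= y.
Proof.
move=> z1 le_y; rewrite -subr_le0.
apply: (cvgr_to_ge (cvg_expr z1)); apply: nearW => k.
by have := le_y k; lra.
Qed.

End GeometricLimits.

(** * Infimum and supremum of the ratios *)

Section CantorRatios.
Variables (R : realType) (m p : nat) (f : 'I_m.+1 -> 'I_p.+1).
Hypothesis m_gt0 : (0 < m)%N.
Hypothesis lt_mp : (m < p)%N.
Hypothesis f0 : f ord0 = 0%N :> nat.
Hypothesis fm : f ord_max = p :> nat.
Local Notation q := (m.+1%:R : R).
Local Notation P := (p.+1%:R : R).
Local Notation al := (alpha R m p).
Local Notation C n := ((cantor_int f n)%:R : R).

Lemma base_gt1 : 1 < q.
Proof. by rewrite ltr1n. Qed.

Lemma base_lt : q < P.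
Proof. by rewrite ltr_nat. Qed.

Lemma base_powR : q `^ al = P.
Proof.
rewrite /powR gt_eqF ?ltr0n // /alpha divfK ?lnK ?posrE ?ltr0n //.
by rewrite gt_eqF // ln_gt0 // base_gt1.
Qed.

Lemma alpha_gt1 : 1 < al.
Proof.
by rewrite ltr_pdivlMr ?ln_gt0 ?base_gt1 // mul1r ltr_ln ?base_lt ?posrE ?ltr0n.
Qed.

Lemma alpha_gt0 : 0 < al.
Proof. exact: lt_trans alpha_gt1. Qed.

Lemma alpha_ge_frac (i j : nat) : (0 < j)%N -> (m.+1 ^ i <= p.+1 ^ j)%N ->
  i%:R / j%:R <= al.
Proof.
move=> j0 le_ij; have lnq : 0 < ln q by rewrite ln_gt0 ?base_gt1.
rewrite ler_pdivrMr ?ltr0n // mulrAC ler_pdivlMr //.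
rewrite mulrC mulr_natr [leRHS]mulr_natr -!lnXn ?ltr0n //.
by rewrite ler_ln ?posrE ?exprn_gt0 ?ltr0n // -!natrX ler_nat.
Qed.

Lemma alpha_le_frac (i j : nat) : (0 < j)%N -> (p.+1 ^ j <= m.+1 ^ i)%N ->
  al <= i%:R / j%:R.
Proof.
move=> j0 le_ij; have lnq : 0 < ln q by rewrite ln_gt0 ?base_gt1.
rewrite ler_pdivlMr ?ltr0n // mulrAC ler_pdivrMr //.
rewrite mulr_natr [leRHS]mulrC [leRHS]mulr_natr -!lnXn ?ltr0n //.
by rewrite ler_ln ?posrE ?exprn_gt0 ?ltr0n // -!natrX ler_nat.
Qed.

Lemma powR_scale (x : R) : 0 <= x -> (q * x) `^ al = P * x `^ al.
Proof. by move=> x0; rewrite powRM // base_powR. Qed.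

Lemma powR_scaleX k (x : R) : 0 <= x -> (q ^+ k * x) `^ al = P ^+ k * x `^ al.
Proof.
move=> x0; elim: k => [|k IH]; first by rewrite !mul1r.
by rewrite !exprS -!mulrA powR_scale ?mulr_ge0 ?exprn_ge0 // IH.
Qed.

Lemma natr_rec n (e : 'I_m.+1) : (m.+1 * n + e)%:R = q * n%:R + e%:R :> R.
Proof. by rewrite natrD natrM. Qed.

Lemma cantor_intR_rec n (e : 'I_m.+1) : C (m.+1 * n + e) = P * C n + (f e)%:R.
Proof. by rewrite cantor_int_rec // natrD natrM. Qed.

Lemma ratio_ge (c : R) n : (0 < n)%N -> (c <= Defs.ratio R f n) = (c * n%:R `^ al <= C n).
Proof. by move=> n0; rewrite ler_pdivlMr // powR_gt0 // ltr0n. Qed.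

Lemma ratio_le (c : R) n : (0 < n)%N -> (Defs.ratio R f n <= c) = (C n <= c * n%:R `^ al).
Proof. by move=> n0; rewrite ler_pdivrMr // powR_gt0 // ltr0n. Qed.

Lemma succ_ratio_ge (c : R) n :
  (c <= succ_ratio R f n) = (c * (n%:R + 1) `^ al <= C n + 1).
Proof. by rewrite ler_pdivlMr // powR_gt0 // natr1 ltr0n. Qed.

Lemma cantor_int_append0 n k : exists N : nat,
  [/\ (n <= N)%N, N%:R = q ^+ k * n%:R & C N = P ^+ k * C n].
Proof.
elim: k => [|k [N [leN eN eC]]]; first by exists n; rewrite !mul1r.
exists (m.+1 * N + (ord0 : 'I_m.+1))%N; split.
- by rewrite addn0 (leq_trans leN) // leq_pmull.
- by rewrite natr_rec addr0 eN exprS mulrA.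
- by rewrite cantor_intR_rec f0 addr0 eC exprS mulrA.
Qed.

Lemma cantor_int_append_max n k : exists N : nat,
  [/\ (n <= N)%N, N%:R + 1 = q ^+ k * (n%:R + 1)
    & C N + 1 = P ^+ k * (C n + 1)].
Proof.
elim: k => [|k [N [leN eN eC]]]; first by exists n; rewrite !mul1r.
exists (m.+1 * N + (ord_max : 'I_m.+1))%N; split.
- by rewrite (leq_trans leN) // (leq_trans _ (leq_addr _ _)) // leq_pmull.
- by rewrite natr_rec exprS -mulrA -eN /= mulrDr mulr1 -addrA natr1.
- by rewrite cantor_intR_rec fm exprS -mulrA -eC mulrDr mulr1 -addrA natr1.
Qed.

Lemma succ_ratio_rec_max n :
  succ_ratio R f (m.+1 * n + (ord_max : 'I_m.+1)) = succ_ratio R f n.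
Proof.
have -> : succ_ratio R f (m.+1 * n + (ord_max : 'I_m.+1)) =
    (P * (C n + 1)) / (q * (n%:R + 1)) `^ al.
  rewrite /succ_ratio natr_rec cantor_intR_rec fm /= -[q]natr1 -[P]natr1.
  by congr (_ / _ `^ _); lra.
rewrite powR_scale ?addr_ge0 // invfM mulrACA divff ?mul1r //.
Qed.

Lemma ratio_lower_bound (c : R) :
  (forall n, (0 < n)%N -> c <= Defs.ratio R f n) <->
  (forall n, (0 < n)%N -> c <= succ_ratio R f n).
Proof.
have inv1 (x : R) : 1 < x -> `|x^-1| < 1.
  move=> x1; have x0 : 0 < x by lra.
  by rewrite gtr0_norm ?invr_gt0 // invf_lt1.
have q1 := base_gt1; have P1 : 1 < P by apply: lt_trans base_lt.
have [q0 P0] : 0 < q /\ 0 < P by lra.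
split=> le_c n n0.
  rewrite succ_ratio_ge; apply: (powR_geometric_limit (inv1 _ q1)).
    by rewrite natr1 ltr0n.
  move=> k; have [N [leN eN eC]] := cantor_int_append_max n k.
  have := le_c N (leq_trans n0 leN); rewrite ratio_ge ?(leq_trans n0) //.
  (* Once q^k is scaled out, the bound for [N] differs from the one wanted by terms that vanish as
     [k] grows. *)
  have -> : N%:R = q ^+ k * (n%:R + 1 - q^-1 ^+ k).
    by rewrite mulrBr -eN -exprMn divff ?gt_eqF // expr1n addrK.
  rewrite powR_scaleX; last first.
    have : q^-1 ^+ k <= 1 by rewrite exprn_ile1 ?invr_ge0 ?invf_le1 ?ltW.
    have : 0 <= n%:R :> R by []. lra.
  rewrite mulrCA => le_CN; rewrite -(ler_pM2l (exprn_gt0 k P0)).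
  by apply: le_trans le_CN _; rewrite -eC; lra.
rewrite ratio_ge //; apply: (geometric_limit (inv1 _ P1)) => k.
(* The main case multiplies N^alpha <= (N + 1)^alpha by [c], which needs c > 0. *)
have [c0|c0] := leP c 0.
  apply: (@le_trans _ _ 0); first by rewrite mulr_le0_ge0 ?powR_ge0.
  by rewrite addr_ge0 ?exprn_ge0 ?invr_ge0 // ltW.
have [N [leN eN eC]] := cantor_int_append0 n k.
have := le_c N (leq_trans n0 leN); rewrite succ_ratio_ge eC => le_CN.
rewrite -(ler_pM2l (exprn_gt0 k P0)) mulrCA -powR_scaleX // -eN.
rewrite mulrDr -exprMn divff ?gt_eqF // expr1n.
apply: le_trans le_CN; rewrite ler_wpM2l ?(ltW c0) //.
by rewrite ge0_ler_powR ?nnegrE ?(ltW alpha_gt0) ?lerDl ?addr_ge0.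
Qed.

(** The infimum of the ratios is a lower bound of them, hence by [ratio_lower_bound] also of the
    shifted ratios, in particular of the one at [n0]. *)
Lemma inf_ratio_eq (c : R) n0 : (0 < n0)%N -> c = succ_ratio R f n0 ->
  (forall n, (0 < n)%N -> c <= succ_ratio R f n) -> inf_ratio R f = c%:E.
Proof.
move=> n0_gt0 c_eq le_c; apply/eqP; rewrite eq_le; apply/andP; split; last first.
  apply/ereal_infP => _ [n n_gt0 <-]; rewrite lee_fin.
  by apply: (iffRL (ratio_lower_bound c)).
have le_inf n : (0 < n)%N -> (inf_ratio R f <= (Defs.ratio R f n)%:E)%E.
  by move=> n_gt0; apply: ge_ereal_inf; exists (Defs.ratio R f n)%:E => //; exists n.
case E : (inf_ratio R f) le_inf => [i| |] le_inf; rewrite ?leNye //; last first.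
  by have := le_inf 1%N isT.
rewrite lee_fin c_eq; apply: (iffLR (ratio_lower_bound i)) => //.
Qed.

Lemma sup_ratioE : sup_ratio R f = (max_ratio_digit R f)%:E.
Proof.
set M := max_ratio_digit R f.
have s1 : 1%N \in index_iota 1 m.+1 by rewrite mem_index_iota.
have leM (e : 'I_m.+1) : (f e)%:R <= M * e%:R `^ al.
  have [e0|e_gt0] := posnP e.
    have -> : e = ord0 by apply: val_inj.
    by rewrite f0 powR0 ?mulr0 // gt_eqF // alpha_gt0.
  rewrite -[f e : nat](cantor_int_digit m_gt0 f0) -ratio_le //.
  by apply: le_bigmax_seq => //; rewrite mem_index_iota e_gt0 ltn_ord.
have M0 : 0 <= M.
  apply: le_trans (_ : Defs.ratio R f 1 <= M); first by rewrite divr_ge0 ?powR_ge0.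
  by apply: le_bigmax_seq => //; rewrite mem_index_iota ltnS m_gt0.
have le_CM : forall n, C n <= M * n%:R `^ al.
  apply: (digit_ind m_gt0) => [e|n e n0 IH]; first by rewrite cantor_int_digit.
  rewrite cantor_intR_rec natr_rec; apply: (@le_trans _ _ (M * ((q * n%:R) `^ al + e%:R `^ al))).
    rewrite powR_scale // mulrDr lerD //.
    by rewrite mulrCA ler_wpM2l.
  by rewrite ler_wpM2l // powR_superadditive ?mulr_ge0 // ltW ?alpha_gt1.
apply/eqP; rewrite eq_le; apply/andP; split.
  apply/ereal_supP => _ [n n_gt0 <-]; rewrite lee_fin ratio_le //.
have [n] := bigmax_attained (Defs.ratio R f) s1.
rewrite mem_index_iota => /andP[n0 _] eM.
by apply: ereal_sup_ubound; exists n => //; rewrite /M /max_ratio_digit eM.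
Qed.

(** A number with more than [l] digits loses its last digit without an increase of the shifted
    ratio, since the prefix is at least q^(l-1); strong induction ends at numbers below q^l. *)
Lemma inf_ratio_level l : (0 < l)%N ->
  (forall n (e : 'I_m.+1), (m.+1 ^ l.-1 <= n)%N ->
     succ_ratio R f n <= succ_ratio R f (m.+1 * n + e)) ->
  inf_ratio R f = (min_succ_ratio R f l)%:E.
Proof.
move=> l0 step.
have s1 : 1%N \in index_iota 1 (m.+1 ^ l).
  by rewrite mem_index_iota leqnn -[X in (X < _)%N](expn0 m.+1) ltn_exp2l.
have [n0] := bigmin_attained (succ_ratio R f) s1.
rewrite mem_index_iota => /andP[n0_gt0 _] eM.
apply: (inf_ratio_eq n0_gt0 eM) => n.
elim: n {-2}n (leqnn n) => [|N IH] n leN n_gt0; first by move: n_gt0; rewrite ltnNge leN.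
have [ltn|len] := ltnP n (m.+1 ^ l).
  by apply: ge_bigmin_seq => //; rewrite mem_index_iota n_gt0.
have le_l : (m.+1 ^ l.-1 <= n %/ m.+1)%N.
  by rewrite leq_divRL // -expnSr prednK.
have lt_r : (n %% m.+1 < m.+1)%N by rewrite ltn_pmod.
have := step _ (Ordinal lt_r) le_l; rewrite /= (mulnC m.+1) -divn_eq.
apply: le_trans; apply: IH.
  by rewrite -ltnS (leq_trans _ leN) // ltn_Pdiv.
by rewrite (leq_trans _ le_l) // expn_gt0.
Qed.

(* Appending the digit [e] to [n] multiplies [n + 1] by [m.+1 * s], and
   [C n + 1] by [p.+1] up to the defect [p - f e]. *)
Lemma succ_ratio_step n (e : 'I_m.+1) (s := 1 - (m%:R - e%:R) / (q * (n%:R + 1)) : R) :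
  p%:R - (f e)%:R <= (C n + 1) * P * (1 - s `^ al) ->
  succ_ratio R f n <= succ_ratio R f (m.+1 * n + e).
Proof.
have n1 : 0 < n%:R + 1 :> R by rewrite natr1 ltr0n.
have s_eq : (m.+1 * n + e)%:R + 1 = q * (n%:R + 1) * s.
  rewrite mulrBr mulr1 [X in _ - X]mulrC divfK ?gt_eqF ?mulr_gt0 //.
  by rewrite natr_rec -[q]natr1; ring.
have s0 : 0 < s.
  have : 0 < q * (n%:R + 1) * s by rewrite -s_eq natr1 ltr0n.
  by rewrite pmulr_rgt0 // mulr_gt0.
move=> le_s; rewrite succ_ratio_ge s_eq powRM ?mulr_ge0 ?(ltW s0) // ?(ltW n1) //.
rewrite powR_scale ?(ltW n1) //; set rho := succ_ratio R f n.
have rhoE : rho * (n%:R + 1) `^ al = C n + 1 by rewrite divfK ?gt_eqF ?powR_gt0.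
have -> : rho * (P * (n%:R + 1) `^ al * s `^ al) = (C n + 1) * P * s `^ al.
  by rewrite -rhoE; ring.
by rewrite cantor_intR_rec; move: le_s; rewrite -[P]natr1; lra.
Qed.

Lemma cantor_int_ge_expn L n :
  (forall x y : 'I_m.+1, (x < y)%N -> (f x < f y)%N) ->
  (m.+1 ^ L <= n)%N -> (p.+1 ^ L <= cantor_int f n)%N.
Proof.
move=> f_incr; elim: L n => [|L IH].
  apply: (digit_ind m_gt0) => [e|n e n0 IH].
    rewrite !expn0 cantor_int_digit // => e0.
    by rewrite -f0; apply: leq_ltn_trans (f_incr ord0 e e0).
  move=> _; rewrite cantor_int_rec // (leq_trans _ (leq_addr _ _)) //.
  by rewrite (leq_trans (IH n0)) // leq_pmull.
move=> n le_n; have lt_r : (n %% m.+1 < m.+1)%N by rewrite ltn_pmod.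
rewrite (divn_eq n m.+1) mulnC.
rewrite (cantor_int_rec m_gt0 f0 (n %/ m.+1) (Ordinal lt_r)).
rewrite (leq_trans _ (leq_addr _ _)) // expnS leq_mul2l IH ?orbT //.
by rewrite leq_divRL // -expnSr.
Qed.

Lemma level_condP l : level_cond R f l <->
  max_end_slope R f <= al * (P ^+ l / q ^+ l.+1).
Proof. by rewrite /level_cond fm !natr1. Qed.

Lemma level_fracE l : al * (P ^+ l / q ^+ l.+1) = (P / q) ^+ l * (al / q).
Proof.
by rewrite expr_div_n exprSr invfM [RHS]mulrACA [LHS]mulrA (mulrC al).
Qed.

(** By [level_fracE] the bound in the condition grows like (P/q)^l with P/q > 1, and Bernoulli's
    inequality makes it exceed any constant. *)
Lemma level_cond_exists : exists2 l : nat, (0 < l)%N & level_cond R f l.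
Proof.
have q_gt0 : 0 < q by rewrite ltr0n.
have [x Px x0] : exists2 x, P / q = 1 + x & 0 < x.
  exists (P / q - 1); first by rewrite addrC subrK.
  by rewrite subr_gt0 ltr_pdivlMr ?mul1r ?base_lt.
have bern (k : nat) : 1 + k%:R * x <= (P / q) ^+ k.
  elim: k => [|k IH]; first by rewrite mul0r addr0.
  have kx : 0 <= k%:R * x ^+ 2 by rewrite mulr_ge0 ?sqr_ge0.
  apply: (@le_trans _ _ ((1 + x) * (1 + k%:R * x))).
    by rewrite -natr1; lra.
  by rewrite -Px exprS ler_wpM2l // divr_ge0.
have aq0 : 0 < al / q := divr_gt0 alpha_gt0 q_gt0.
set A := max_end_slope R f / (al / q) / x.
have [l l0 lA] : exists2 l : nat, (0 < l)%N & A <= l%:R.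
  exists (Num.bound `|A|).+1 => //.
  apply: le_trans (ler_norm A) (le_trans (ltW (archi_boundP (normr_ge0 A))) _).
  by rewrite ler_nat.
exists l => //; apply/level_condP.
rewrite level_fracE -ler_pdivrMr //.
apply: le_trans (bern l); apply: (@le_trans _ _ (l%:R * x)); last by lra.
by rewrite -ler_pdivrMr.
Qed.

Lemma level_condW k l : (k <= l)%N -> level_cond R f k -> level_cond R f l.
Proof.
move=> le_kl /level_condP le_k; apply/level_condP; apply: le_trans le_k _.
have q_gt0 : 0 < q by rewrite ltr0n.
rewrite !level_fracE ler_wpM2r ?(ltW (divr_gt0 alpha_gt0 q_gt0)) //.
by rewrite ler_weXn2l // ler_pdivlMr // mul1r ltW // base_lt.
Qed.

Lemma succ_ratio_step_level l n (e : 'I_m.+1) :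
  (forall x y : 'I_m.+1, (x < y)%N -> (f x < f y)%N) ->
  (0 < l)%N -> level_cond R f l -> (m.+1 ^ l.-1 <= n)%N ->
  succ_ratio R f n <= succ_ratio R f (m.+1 * n + e).
Proof.
move=> f_incr l0 cond_l le_n.
have [->|e_max] := eqVneq e ord_max; first by rewrite succ_ratio_rec_max.
have lt_em : (e < m)%N.
  by move: e_max (ltn_ord e); rewrite -val_eqE /= ltnS leq_eqVlt => /negbTE ->.
have n_gt0 : (0 < n)%N by rewrite (leq_trans _ le_n) // expn_gt0.
set L := trunc_log m.+1 n.
have le_Ln : (m.+1 ^ L <= n)%N by rewrite trunc_logP.
have lt_nL : (n < m.+1 ^ L.+1)%N by rewrite trunc_log_ltn.
(* As [n] has L + 1 >= l digits, the condition passes to that level, where P^L <= C n and n + 1 <=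
   q^(L+1). *)
have cond_L : level_cond R f L.+1.
  by apply: level_condW cond_l; rewrite -(prednK l0) ltnS trunc_log_max.
have le_C : P ^+ L <= C n by rewrite -natrX ler_nat cantor_int_ge_expn.
have le_q : n%:R + 1 <= q ^+ L.+1 by rewrite -natrX natr1 ler_nat.
have d0 : 0 < m%:R - e%:R :> R by rewrite subr_gt0 ltr_nat.
have N0 : 0 < q * (n%:R + 1) by rewrite mulr_gt0 ?natr1 ?ltr0n.
have fe : p%:R - (f e)%:R <= al * (P ^+ L.+1 / q ^+ L.+2) * (m%:R - e%:R).
  rewrite -ler_pdivrMr //; move/level_condP: cond_L; apply: le_trans.
  have := @le_bigmax_cond _ _ _ (end_slope R f ord0) e
    (fun e => e != ord_max) (end_slope R f) e_max.
  by apply: le_trans; rewrite /end_slope fm.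
apply: succ_ratio_step; set t := (m%:R - e%:R) / _; set s := 1 - t.
have s0 : 0 < s.
  rewrite subr_gt0 ltr_pdivrMr // mul1r -[q]natr1.
  have : 0 <= n%:R :> R by []. have : 0 <= e%:R :> R by [].
  have : 0 <= m%:R :> R by []. nra.
have C0 : 0 <= C n by [].
have P0 : 0 < P by rewrite ltr0n.
(* In the first case (C n + 1) (1 - s^alpha) >= 1, and p - f e is less than [P]. *)
have [small|large] := leP (s `^ al * (C n + 1)) (C n).
  apply: (@le_trans _ _ P); first by rewrite -[P]natr1 lerBlDr; have : 0 <= (f e)%:R :> R by []; lra.
  nra.
have := powR_tangent s0 (ltW alpha_gt0); have -> : 1 - s = t by rewrite /s; lra.
move=> tan; apply: (le_trans fe).
have t0 : 0 < t by rewrite divr_gt0.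
apply: (@le_trans _ _ (P * (al * t * C n))).
  have -> : m%:R - e%:R = t * (q * (n%:R + 1)) by rewrite divfK ?gt_eqF.
  have -> : P * (al * t * C n) = al * t * P * C n by ring.
  have cancel (b Q N X Y : R) : Q != 0 -> Y != 0 ->
      al * (b * X / (Q * Y)) * (t * (Q * N)) = al * t * b * (X * (N / Y)).
    by move=> Q0 Y0; field; rewrite ?Q0 ?Y0.
  rewrite (exprS P) (exprS q L.+1) cancel ?expf_neq0 ?pnatr_eq0 //.
  rewrite ler_wpM2l ?(mulr_ge0 (mulr_ge0 (ltW alpha_gt0) (ltW t0)) (ltW P0)) //.
  apply: le_trans le_C; rewrite ler_piMr ?exprn_ge0 //.
  by rewrite ler_pdivrMr ?mul1r // exprn_gt0 // ltr0n.
rewrite (mulrC (C n + 1)) -[leRHS]mulrA ler_wpM2l ?(ltW P0) //.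
apply: (@le_trans _ _ ((C n + 1) * (al * t * s `^ al))).
  have : 0 <= al * t := mulr_ge0 (ltW alpha_gt0) (ltW t0).
  nra.
by rewrite ler_wpM2l // addr_ge0.
Qed.

Lemma succ_ratio_max_digit : succ_ratio R f m = 1.
Proof.
rewrite /succ_ratio (cantor_int_digit m_gt0 f0 (ord_max : 'I_m.+1)) fm !natr1.
by rewrite base_powR divff ?pnatr_eq0.
Qed.

(** For a digit, convexity between 1 and [q] gives (e + 1)^alpha <= f e + 1. For the induction,
    raising the last digit to [m] increases (q n + e + 1)^alpha by at least P - (e + 1)^alpha, by
    [powR_increment]. *)
Lemma succ_ratio_ge1 : (forall e : 'I_m.+1, (p * e <= m * f e)%N) ->
  forall n, 1 <= succ_ratio R f n.
Proof.
move=> chord n; rewrite succ_ratio_ge mul1r.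
have q1 := base_gt1; have al1 := alpha_gt1.
have m0 : 0 < m%:R :> R by rewrite ltr0n.
have digit_le (e : 'I_m.+1) : (e%:R + 1) `^ al <= (f e)%:R + 1.
  set l := e%:R / m%:R : R.
  have l01 : 0 <= l <= 1.
    by rewrite divr_ge0 // ler_pdivrMr // mul1r ler_nat -ltnS ltn_ord.
  have -> : e%:R + 1 = l * q + (1 - l) * 1 :> R.
    have : l * m%:R = e%:R by rewrite divfK // gt_eqF.
    by rewrite -[q]natr1; lra.
  apply: le_trans (powR_convex l01 _ _ (ltW al1)) _ => //.
  rewrite base_powR powR1 -[P]natr1.
  suff : l * p%:R <= (f e)%:R by lra.
  rewrite /l mulrAC ler_pdivrMr // mulrC [leRHS]mulrC -!natrM ler_nat.
  exact: chord.
elim/(digit_ind m_gt0) : n => [e|n e n0 IH].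
  by rewrite cantor_int_digit.
rewrite natr_rec cantor_intR_rec.
have le_e : e%:R <= m%:R :> R by rewrite ler_nat -ltnS ltn_ord.
have qn0 : 0 <= q * n%:R by rewrite mulr_ge0.
have xy : 0 <= (e%:R + 1 : R) <= q * n%:R + e%:R + 1.
  by apply/andP; split; [rewrite addr_ge0 | rewrite lerD2r lerDr].
have t0 : 0 <= m%:R - e%:R :> R by rewrite subr_ge0.
have := powR_increment xy t0 (ltW al1).
have -> : e%:R + 1 + (m%:R - e%:R) = q by rewrite -[q]natr1; lra.
have -> : q * n%:R + e%:R + 1 + (m%:R - e%:R) = q * (n%:R + 1).
  by rewrite -[q]natr1; ring.
have n1 : 0 <= n%:R + 1 :> R by rewrite natr1.
rewrite base_powR powR_scale //.
have : P * (n%:R + 1) `^ al <= P * (C n + 1) by rewrite ler_wpM2l.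
by have := digit_le e; lra.
Qed.

Lemma max_digit_in_range l : (0 < l)%N -> m \in index_iota 1 (m.+1 ^ l).
Proof.
by move=> l0; rewrite mem_index_iota m_gt0 -[X in (X <= _)%N]expn1 leq_pexp2l.
Qed.

Lemma min_succ_ratio_le1 l : (0 < l)%N -> min_succ_ratio R f l <= 1.
Proof.
by move=> l0; rewrite -succ_ratio_max_digit ge_bigmin_seq // max_digit_in_range.
Qed.

Lemma inf_ratio_chord l : (0 < l)%N ->
  (forall e : 'I_m.+1, (p * e <= m * f e)%N) ->
  [/\ inf_ratio R f = (min_succ_ratio R f l)%:E, min_succ_ratio R f l = 1
    & 1 <= min_succ_ratio_two_digits R f].
Proof.
move=> l0 /succ_ratio_ge1 ge1.
have minE : min_succ_ratio R f l = 1.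
  by apply/eqP; rewrite eq_le min_succ_ratio_le1 // le_bigmin.
split=> //; last by rewrite le_bigmin.
by rewrite minE; apply: (inf_ratio_eq m_gt0) => //; rewrite succ_ratio_max_digit.
Qed.

(** * Quadratic base conversion functions *)

Section Quadratic.
(** The form a x (x - 1) + c x has c = f 1, so that both coefficients are positive integers. *)
Variables a c : nat.
Hypothesis m_gt1 : (1 < m)%N.
Hypothesis a_gt0 : (0 < a)%N.
Hypothesis c_gt0 : (0 < c)%N.
Hypothesis fE : forall x : 'I_m.+1,
  (f x)%:R = a%:R * (x%:R * (x%:R - 1)) + c%:R * x%:R :> R.

Lemma base_quad : P = a%:R * (m%:R * (m%:R - 1)) + c%:R * m%:R + 1.
Proof. by rewrite -natr1 -fm fE. Qed.

Lemma digit_ge (e : 'I_m.+1) : c%:R * e%:R <= (f e)%:R :> R.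
Proof.
rewrite fE lerDr mulr_ge0 //; case: (nat_of_ord e) => [|k]; first by rewrite mul0r.
by rewrite -natr1 addrK mulr_ge0.
Qed.

Lemma cantor_int_ge n : c%:R * n%:R <= C n.
Proof.
elim/(digit_ind m_gt0) : n => [e|n e n0 IH].
  by rewrite cantor_int_digit // digit_ge.
rewrite natr_rec cantor_intR_rec mulrDr lerD ?digit_ge //.
by rewrite mulrCA ler_pM // ltW // base_lt.
Qed.

Lemma base_lower : m%:R ^+ 2 + 1 <= P.
Proof.
rewrite base_quad; have a1 : 1 <= a%:R :> R by rewrite ler1n.
have c1 : 1 <= c%:R :> R by rewrite ler1n.
have m2 : 2 <= m%:R :> R by rewrite ler_nat.
have m0 : 0 <= m%:R * (m%:R - 1) :> R by rewrite mulr_ge0; lra.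
have : 0 <= (a%:R - 1) * (m%:R * (m%:R - 1)) :> R by rewrite mulr_ge0; lra.
have : 0 <= (c%:R - 1) * m%:R :> R by rewrite mulr_ge0; lra.
lra.
Qed.

(** From q^2 <= 2 (m^2 + 1) and 4 <= m^2 + 1 <= P one gets q^4 <= 4 (m^2 + 1)^2 <= P^3. *)
Lemma alpha_ge43 : 4 / 3 <= al.
Proof.
apply: (@alpha_ge_frac 4 3) => //.
have /(leq_trans _) : (m ^ 2 + 1 <= p.+1)%N.
  by rewrite -(ler_nat R) natrD natrX base_lower.
have le_q : (m.+1 ^ 2 <= 2 * (m ^ 2 + 1))%N.
  by rewrite -mulnn; nia.
have m4 : (4 <= m ^ 2 + 1)%N by rewrite -mulnn; nia.
move=> le_p; apply: (@leq_trans ((m ^ 2 + 1) ^ 3)); last by rewrite leq_exp2r // le_p.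
apply: (@leq_trans ((2 * (m ^ 2 + 1)) ^ 2)); first by rewrite (expnM _ 2 2) leq_exp2r.
by rewrite expnMn [leqRHS]expnS leq_mul2r m4 orbT.
Qed.

(** With n = q u + v, C u >= c u and f v >= c v, the quotient of P c u + c v + 1 by n + 1 is least
    at u = 1, v = m, which gives the constants. *)
Lemma cantor_int_growth n : (m.+1 <= n)%N ->
  (P * c%:R + 1 + c%:R * m%:R) * (n%:R + 1) <= 2 * q * (C n + 1).
Proof.
move=> le_n; have lt_r : (n %% m.+1 < m.+1)%N by rewrite ltn_pmod.
have nE := divn_eq n m.+1; set u := (n %/ m.+1)%N in nE.
set v : 'I_m.+1 := Ordinal lt_r.
have {}nE : n = (m.+1 * u + v)%N by rewrite mulnC.
have u1 : 1 <= u%:R :> R by rewrite ler1n divn_gt0.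
have vm : v%:R <= m%:R :> R by rewrite ler_nat -ltnS ltn_ord.
have v0 : 0 <= v%:R :> R by [].
rewrite nE natr_rec cantor_intR_rec.
have Cu := cantor_int_ge u; have fv := digit_ge v.
have Pm := base_lower; have m2 : 2 <= m%:R :> R by rewrite ler_nat.
have c1 : 1 <= c%:R :> R by rewrite ler1n.
rewrite -[q]natr1; clear nE; clearbody u v.
move: (m%:R) (c%:R) (u%:R) (v%:R) P (C u) ((f v)%:R) => M X U V B D F in u1 vm v0 Cu fv Pm m2 c1 *.
have BXU : B * (X * U) <= B * D by rewrite ler_wpM2l //; nra.
apply: (@le_trans _ _ (2 * (M + 1) * (B * (X * U) + X * V + 1))); last first.
  by rewrite ler_wpM2l; lra.
have MX : 0 <= X * (B - 2 * M) by rewrite mulr_ge0 //; nra.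
have XB : 0 <= X * (B - M - 2) by rewrite mulr_ge0 //; nra.
have : 0 <= (U - 1) * ((M + 1) * (B * X - 1 - X * M)).
  by rewrite mulr_ge0 ?mulr_ge0 //; nra.
have : 0 <= (M - V) * (X * (B - M - 2) + 1) by rewrite mulr_ge0; lra.
nra.
Qed.

(** Sharper than [cantor_int_growth], since the exact values of [f] are used; equality holds at n =
    4, with digits 1, 1. *)
Lemma cantor_int_growth_2_1 n : m = 2 -> c = 1%N -> (m.+1 <= n)%N ->
  (P + 2) * (n%:R + 1) <= 5 * (C n + 1).
Proof.
move=> m2 c1 le_n; have lt_r : (n %% m.+1 < m.+1)%N by rewrite ltn_pmod.
have nE := divn_eq n m.+1; set u := (n %/ m.+1)%N in nE.
set v : 'I_m.+1 := Ordinal lt_r.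
have {}nE : n = (m.+1 * u + v)%N by rewrite mulnC.
have u1 : 1 <= u%:R :> R by rewrite ler1n divn_gt0.
rewrite nE natr_rec cantor_intR_rec.
have Cu := cantor_int_ge u; have fv := fE v.
have PE := base_quad; have Pm := base_lower.
have mE : m%:R = 2 :> R by rewrite m2.
have vE : (v%:R = 0 :> R) \/ (v%:R = 1 :> R) \/ (v%:R = 2 :> R).
  have : (v <= 2)%N by rewrite -ltnS (leq_trans (ltn_ord v)) // m2.
  case: (nat_of_ord v) => [|[|[|k]]] // _; first by left.
    by right; left.
  by right; right.
rewrite -[q]natr1; clear nE; clearbody u v.
have cE : c%:R = 1 :> R by rewrite c1.
rewrite mE cE in Cu fv PE Pm *.
have PU : P * u%:R <= P * C u by rewrite ler_wpM2l //; lra.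
have PU1 : 0 <= (P - 3) * (u%:R - 1) by rewrite mulr_ge0 //; lra.
by case: vE => [vE|[vE|vE]]; rewrite fv vE; lra.
Qed.

(** The factor m - e of p - f e cancels against the one in [t], and [onem_powR_ge] replaces 1 - (1 -
    t)^alpha by t (4 - t) / 3; the polynomial inequality left is [quad_step_generic] or
    [quad_step_two]. *)
Lemma succ_ratio_step_quad n (e : 'I_m.+1) : (m <= n)%N ->
  succ_ratio R f n <= succ_ratio R f (m.+1 * n + e).
Proof.
move=> le_mn; have [->|e_max] := eqVneq e ord_max.
  by rewrite succ_ratio_rec_max.
have lt_em : (e < m)%N.
  by move: e_max (ltn_ord e); rewrite -val_eqE /= ltnS leq_eqVlt => /negbTE ->.
apply: succ_ratio_step; set d := m%:R - e%:R; set N := n%:R + 1.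
have N_ge : q <= N by rewrite /N natr1 ler_nat ltnS.
have d0 : 0 < d by rewrite subr_gt0 ltr_nat.
have dm : d <= m%:R by rewrite lerBlDr lerDl.
have q_gt0 : 0 < q by rewrite ltr0n.
have N0 : 0 < N := lt_le_trans q_gt0 N_ge.
have qN0 : 0 < q * N by rewrite mulr_gt0.
set t := d / (q * N); have tE : t * (q * N) = d by rewrite divfK ?gt_eqF.
have t0 : 0 < t by rewrite divr_gt0.
have m2 : 2 <= m%:R :> R by rewrite ler_nat.
have t1 : t < 1.
  rewrite ltr_pdivrMr // mul1r; apply: le_lt_trans dm _.
  apply: (@lt_le_trans _ _ q); first by rewrite ltr_nat.
  by rewrite ler_peMr ?(ltW q_gt0) // (le_trans (ltW base_gt1)).
have t01 : 0 <= t < 1 by rewrite (ltW t0).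
have A0 : 0 <= C n + 1 by [].
have P0 : 0 <= P by [].
apply: (@le_trans _ _ ((C n + 1) * P * (t * (4 - t) / 3))); last first.
  by rewrite ler_wpM2l ?mulr_ge0 // onem_powR_ge // alpha_ge43.
have -> : p%:R - (f e)%:R = d * (a%:R * (m%:R - 1 + e%:R) + c%:R).
  have -> : p%:R = (f ord_max)%:R :> R by rewrite fm.
  by rewrite !fE /d /=; ring.
rewrite -[X in X * _]tE; set S := _ + c%:R.
suff key : 3 * (q * N) * S <= (C n + 1) * P * (4 - t).
  have -> : (C n + 1) * P * (t * (4 - t) / 3) = t / 3 * ((C n + 1) * P * (4 - t)).
    by ring.
  have -> : t * (q * N) * S = t / 3 * (3 * (q * N) * S) by field.
  by rewrite ler_wpM2l // divr_ge0 // ltW.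
have dq : t * (q * q) <= d.
  by rewrite -[leRHS]tE ler_wpM2l ?(ltW t0) // ler_wpM2l // ltW.
have nE : n = m \/ (m.+1 <= n)%N by move: le_mn; rewrite leq_eqVlt => /orP[/eqP|]; [left | right].
have e0 : 0 <= e%:R :> R by [].
have em : e%:R + 1 <= m%:R :> R by rewrite natr1 ler_nat.
have a1 : 1 <= a%:R :> R by rewrite ler1n.
have PE := base_quad.
have CnP : n = m -> C n + 1 = P /\ N = q.
  move=> nm; rewrite /N nm (cantor_int_digit m_gt0 f0 (ord_max : 'I_m.+1)) fm.
  by rewrite !natr1.
have qE : q = m%:R + 1 by rewrite natr1.
have [/andP[/eqP mE /eqP cE]|large] := boolP ((m == 2) && (c == 1))%N.
  have mR : m%:R = 2 :> R by rewrite mE.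
  have cR : c%:R = 1 :> R by rewrite cE.
  have grow := cantor_int_growth_2_1 mE cE.
  rewrite /S cR mR; rewrite qE mR cR /d in PE dq CnP N_ge em *.
  apply: quad_step_two => //; first by rewrite (ltW t0) ltW.
  - by rewrite -[X in _ <= X - _]mR.
  - by case: nE => [/CnP|/grow]; [left | right].
rewrite [X in 3 * (X * N)]qE.
apply: quad_step_generic => //; first by rewrite (ltW t0) ltW.
- by rewrite -qE (le_trans dq).
- by rewrite -qE.
- have [c2|c_le1] := ltnP 1 c; first by right; rewrite ler_nat.
  have cE : c = 1%N by apply/eqP; rewrite eqn_leq c_le1.
  left; split; last by rewrite cE.
  by rewrite ler_nat ltn_neqAle eq_sym m_gt1 andbT; move: large; rewrite cE andbT.
- by rewrite -qE; case: nE => [/CnP|/cantor_int_growth]; [left | right].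
Qed.

(** * Two-digit numbers *)

Local Notation rest v := (((f v)%:R + 1) / P).
Local Notation shift v := ((v%:R + 1) / q).

Lemma succ_ratio_two_digits (u v : 'I_m.+1) :
  succ_ratio R f (m.+1 * u + v) = ((f u)%:R + rest v) / (u%:R + shift v) `^ al.
Proof.
have q0 : q != 0 by rewrite pnatr_eq0.
have P0 : P != 0 by rewrite pnatr_eq0.
have s0 : 0 <= u%:R + shift v by rewrite addr_ge0 ?divr_ge0.
have -> : succ_ratio R f (m.+1 * u + v) =
    (P * ((f u)%:R + rest v)) / (q * (u%:R + shift v)) `^ al.
  rewrite /succ_ratio natr_rec cantor_intR_rec cantor_int_digit // -!addrA.
  by rewrite !mulrDr ![_ * (_ / _)]mulrC !divfK.
by rewrite powR_scale // invfM mulrACA divff ?mul1r.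
Qed.

Lemma trailing_bounds (v : 'I_m.+1) : [/\ 0 <= shift v <= 1, 0 <= rest v <= shift v &
  (c <= a.+1)%N -> q ^+ 2 <= P -> rest v <= shift v ^+ 2].
Proof.
have q0 : 0 < q by rewrite ltr0n.
have P0 : 0 < P by rewrite ltr0n.
have vm : v%:R <= m%:R :> R by rewrite ler_nat -ltnS ltn_ord.
have v0m : 0 <= (v%:R : R) <= m%:R by rewrite ler0n.
have m1 : 1 <= m%:R :> R by rewrite ler1n.
have c1 : 1 <= c%:R :> R by rewrite ler1n.
have a1 : 1 <= a%:R :> R by rewrite ler1n.
have qE : q = m%:R + 1 by rewrite natr1.
split.
- by rewrite divr_ge0 //= ler_pdivrMr // mul1r qE lerD2r.
- rewrite divr_ge0 //= ler_pdivrMr // mulrAC ler_pdivlMr // fE qE.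
  exact: (trailing_le m1 (ler0n _ _) c1 v0m base_quad).
- move=> ca; rewrite qE => le_P.
  rewrite ler_pdivrMr // expr_div_n mulrAC ler_pdivlMr ?exprn_gt0 // fE.
  apply: (trailing_le_sqr m1 a1 _ v0m base_quad) => //.
  by rewrite natr1 ler_nat.
Qed.

Lemma leading_one (v : 'I_m.+1) : (m.+1 * 1 + v = m + v + 1)%N.
Proof. by rewrite muln1 addSn addn1. Qed.

Lemma min_two_digits_le (v : 'I_m.+1) :
  min_succ_ratio_two_digits R f <= succ_ratio R f (m.+1 * 1 + v).
Proof. by rewrite leading_one bigmin_le. Qed.

Lemma alpha_le_real (i j : nat) : (0 < j)%N -> P ^+ j <= q ^+ i -> al <= i%:R / j%:R.
Proof. by move=> j0; rewrite -!natrX ler_nat; apply: alpha_le_frac. Qed.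

Lemma succ_ratio_interior_large (u v : 'I_m.+1) : (3 <= m)%N -> (0 < u)%N ->
  q ^+ 2 <= P ->
  Num.min (succ_ratio R f (m.+1 * 1 + v))
          (succ_ratio R f (m.+1 * m + v)) <= succ_ratio R f (m.+1 * u + v).
Proof.
move=> m3 u0 le_P; have m3R : 3 <= m%:R :> R by rewrite ler_nat.
have al2 : 2 <= al.
  have := @alpha_ge_frac 2 1 isT; rewrite divr1; apply.
  by rewrite -(ler_nat R) natrX.
have [/andP[s0 s1] r0s r_le] := trailing_bounds v.
have quadE (x : 'I_m.+1) : succ_ratio R f (m.+1 * x + v) =
    (a%:R * x%:R ^+ 2 + (c%:R - a%:R) * x%:R + rest v) * (x%:R + shift v) `^ (- al).
  rewrite succ_ratio_two_digits powRN fE; congr ((_ + _) * _); ring.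
have lt1 : (1 < m.+1)%N by rewrite ltnS.
have := quadE (Ordinal lt1); have := quadE ord_max; rewrite /= => -> ->.
rewrite quadE; apply: quad_powR_quasiconcave => //; last first.
  by rewrite ler1n u0 ler_nat -ltnS ltn_ord.
have -> : 2 * a%:R + (c%:R - a%:R) = a%:R + c%:R :> R by ring.
have -> : a%:R + (c%:R - a%:R) = c%:R :> R by rewrite addrC subrK.
have qE : q = m%:R + 1 by rewrite natr1.
have [b1 b2 b3 b4] := exceptional_bases P m3R.
apply: slope_at_one => //; rewrite ?s0 //.
- by move=> ca; exact: r_le.
(* For a = 1 and c <= 2, P <= m^2 + m + 1 < q^2. *)
- move=> aE; rewrite leqNgt; apply/negP => c3; move: le_P; rewrite base_quad qE aE.
  have c2R : c%:R <= 2 :> R by rewrite ler_nat -ltnS.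
  rewrite leNgt => /negP; apply.
  have : 0 <= (2 - c%:R) * m%:R :> R by rewrite mulr_ge0 //; lra.
  lra.
- move=> aE cE; have := @alpha_le_real 3 1 isT; rewrite divr1 qE; apply; apply: b1.
  by rewrite base_quad aE cE.
- move=> aE cE; apply: (@alpha_le_real 5 2) => //; rewrite qE; apply: b2.
  by rewrite base_quad aE cE.
- move=> aE cE; apply: (@alpha_le_real 7 3) => //; rewrite qE; apply: b3.
  by rewrite base_quad aE cE.
- move=> aE cE; apply: (@alpha_le_real 5 2) => //; rewrite qE; apply: b4.
  by rewrite base_quad aE cE.
Qed.

(** Since y/x >= 1, (y/x)^alpha <= (y/x)^2, so the comparison may be made with exponent 2. *)
Lemma powR_ratio_le (x y A B : R) : al <= 2 -> 0 < x <= y -> 0 <= A ->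
  A * y ^+ 2 <= B * x ^+ 2 -> A / x `^ al <= B / y `^ al.
Proof.
move=> al2 /andP[x0 xy] A0 le_AB; have y0 : 0 < y := lt_le_trans x0 xy.
have [X0 Y0] : 0 < x `^ al /\ 0 < y `^ al by rewrite !powR_gt0.
rewrite ler_pdivrMr // mulrAC ler_pdivlMr //.
have rho1 : 1 <= y / x by rewrite ler_pdivlMr // mul1r.
have rho0 : 0 <= y / x by rewrite divr_ge0 ?ltW.
have -> : y `^ al = x `^ al * (y / x) `^ al.
  by rewrite -powRM // ?(ltW x0) // mulrC divfK // gt_eqF.
rewrite mulrCA mulrC ler_wpM2r ?(ltW X0) //.
apply: (@le_trans _ _ (A * (y / x) `^ 2)); first by rewrite ler_wpM2l // ler_powR.
by rewrite (powR_mulrn 2 rho0) expr_div_n mulrA ler_pdivrMr ?exprn_gt0.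
Qed.

Lemma succ_ratio_interior_small (u v : 'I_m.+1) : (3 <= m)%N -> (1 < u)%N ->
  P < q ^+ 2 ->
  min_succ_ratio_two_digits R f <= succ_ratio R f (m.+1 * u + v).
Proof.
move=> m3 u1 lt_P; have m3R : 3 <= m%:R :> R by rewrite ler_nat.
have al2 : al <= 2.
  by have := @alpha_le_real 2 1 isT; rewrite divr1; apply; rewrite expr1 ltW.
have qE : q = m%:R + 1 by rewrite natr1.
have u2R : 2 <= u%:R :> R by rewrite ler_nat.
have [/andP[s0 s1] /andP[r0 rs] _] := trailing_bounds v.
have lt1 : (1 < m.+1)%N by rewrite ltnS.
have := lt_P; rewrite qE => /(base_lt_sqr a_gt0 c_gt0 m3R base_quad) [aE [cE|cE]].
  (* For f = x^2 the comparison keeps the trailing digit [v]. *)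
  apply: le_trans (min_two_digits_le v) _.
  have := succ_ratio_two_digits (Ordinal lt1) v; rewrite /= => ->.
  rewrite succ_ratio_two_digits; apply: powR_ratio_le => //.
    by rewrite ltr_pwDl //= lerD2r ler1n ltnW.
  rewrite (fE u) (fE (Ordinal lt1)) aE cE /=.
  have -> : 1%N%:R * (1%N%:R * (1%:R - 1)) + 1%N%:R * 1%N%:R = 1 :> R by ring.
  have -> : 1%N%:R * (u%:R * (u%:R - 1)) + 1%:R * u%:R = u%:R ^+ 2 :> R by ring.
  by apply: square_leading_le => //; lra.
(* For f = x^2 + x the trailing digit [m] serves for every [v]; its ratio is 3 / 2^alpha. *)
apply: le_trans (min_two_digits_le ord_max) _.
have := succ_ratio_two_digits (Ordinal lt1) ord_max; rewrite /= => ->.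
rewrite fm !natr1 !divff ?pnatr_eq0 // succ_ratio_two_digits.
apply: powR_ratio_le => //; first by rewrite addr_gt0 //= ler_wpDr.
rewrite (fE u) (fE v) (fE (Ordinal lt1)) aE cE /=.
have -> : 1%N%:R * (1%N%:R * (1%:R - 1)) + 2%N%:R * 1%:R + 1 = 3 :> R by ring.
have -> : 1%N%:R * (u%:R * (u%:R - 1)) + 2%N%:R * u%:R = u%:R ^+ 2 + u%:R :> R by ring.
apply: pronic_leading_le; rewrite ?s0 ?s1 //.
rewrite expr_div_n [leLHS]mulrA ler_pdivrMr ?exprn_gt0 // [leRHS]mulrAC ler_pdivlMr //.
have := @pronic_trailing_ge R m%:R v%:R P (ler0n _ _).
rewrite -qE; have -> : 1%N%:R * (v%:R * (v%:R - 1)) + 2%N%:R * v%:R + 1 = v%:R ^+ 2 + v%:R + 1 :> R by ring.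
by apply; rewrite base_quad aE cE; ring.
Qed.

Lemma succ_ratio_two_digits_ge (u v : 'I_m.+1) : (0 < u)%N ->
  Num.min 1 (min_succ_ratio_two_digits R f) <= succ_ratio R f (m.+1 * u + v).
Proof.
(* Appending [v] to the digit [m], whose shifted ratio is 1, cannot decrease the ratio. *)
move=> u0; have max_ge1 : 1 <= succ_ratio R f (m.+1 * m + v).
  by rewrite -succ_ratio_max_digit succ_ratio_step_quad.
have [u1|u1] := leqP u 1.
  have -> : nat_of_ord u = 1%N by apply/eqP; rewrite eqn_leq u1.
  by rewrite ge_min min_two_digits_le orbT.
have [um|lt_um] := leqP m u.
  have -> : nat_of_ord u = m by apply/eqP; rewrite eqn_leq um -ltnS ltn_ord.
  by rewrite ge_min max_ge1.
have m3 : (2 < m)%N by apply: leq_ltn_trans lt_um.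
have [le_P|lt_P] := leP (q ^+ 2) P; last first.
  by rewrite ge_min succ_ratio_interior_small ?orbT.
apply: le_trans (succ_ratio_interior_large v m3 u0 le_P).
by rewrite le_min !ge_min max_ge1 min_two_digits_le orbT.
Qed.

Lemma min_succ_ratio_quad :
  min_succ_ratio R f 2 = Num.min 1 (min_succ_ratio_two_digits R f).
Proof.
apply/eqP; rewrite eq_le; apply/andP; split.
  rewrite le_min min_succ_ratio_le1 //=.
  have in_range (e : 'I_m.+1) : succ_ratio R f (m + e + 1) >= min_succ_ratio R f 2.
    apply: ge_bigmin_seq => //; rewrite mem_index_iota addn1 /=.
    by rewrite expnS expn1; have := ltn_ord e; nia.
  rewrite le_bigmin //; exact: (in_range ord0).
have digits_ge n : (0 < n < m.+1 ^ 2)%N ->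
    Num.min 1 (min_succ_ratio_two_digits R f) <= succ_ratio R f n.
  move=> /andP[n0 lt_n]; have [lt_nm|le_mn] := ltnP n m.+1.
    (* A single digit becomes a two-digit number of equal ratio by appending [m]. *)
    rewrite -succ_ratio_rec_max.
    exact: (succ_ratio_two_digits_ge (u := Ordinal lt_nm) ord_max n0).
  have lt_r : (n %% m.+1 < m.+1)%N by rewrite ltn_pmod.
  have lt_u : (n %/ m.+1 < m.+1)%N by rewrite ltn_divLR // mulnn.
  rewrite (divn_eq n m.+1) mulnC.
  apply: (succ_ratio_two_digits_ge (u := Ordinal lt_u) (Ordinal lt_r)).
  by rewrite /= divn_gt0.
have range1 : (0 < 1 < m.+1 ^ 2)%N by rewrite expnS expn1; nia.
rewrite /min_succ_ratio big_seq le_bigmin ?digits_ge // => n.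
by rewrite mem_index_iota => /digits_ge.
Qed.

Lemma inf_ratio_quad : inf_ratio R f = (min_succ_ratio R f 2)%:E.
Proof.
apply: inf_ratio_level => // n e; rewrite expn1 => le_n.
by rewrite succ_ratio_step_quad // ltnW.
Qed.

End Quadratic.
End CantorRatios.

(** * Assembly of the three claims *)

Theorem theorem1p1 (R : realType) (m p : nat) (f : 'I_m.+1 -> 'I_p.+1)
    (m_gt0 : (0 < m)%N) (lt_mp : (m < p)%N)
    (f_incr : forall x y : 'I_m.+1, (x < y)%N -> (f x < f y)%N)
    (f0 : f ord0 = 0%N :> nat) (fm : f ord_max = p :> nat) :
  [/\ sup_ratio R f = (max_ratio_digit R f)%:E,
      exists l0 : nat, is_least_level R f l0 /\
        inf_ratio R f = (min_succ_ratio R f l0)%:E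
    & forall a b : int,
        (forall x : 'I_m.+1, (f x)%:Z = a * x%:Z ^+ 2 + b * x%:Z) ->
        (forall x : R, 1 <= x <= m%:R -> 0 < 2 * a%:~R * x + b%:~R) ->
        inf_ratio R f = (min_succ_ratio R f 2)%:E /\
        min_succ_ratio R f 2 =
          (if a <= 0 then 1
           else Num.min 1 (min_succ_ratio_two_digits R f))].
Proof.
split; first exact: sup_ratioE.
  have [l l_gt0 cond_l] := level_cond_exists R m_gt0 lt_mp fm.
  have level_ex : exists l, (0 < l)%N && `[< level_cond R f l >].
    by exists l; rewrite l_gt0; apply/asboolP.
  have := ex_minnP level_ex => -[l0 /andP[l0_gt0 /asboolP cond_l0] l0_min].
  exists l0; split.
    by split=> // k k_gt0 cond_k; apply: l0_min; rewrite k_gt0; apply/asboolP.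
  apply: inf_ratio_level => // n e le_n.
  exact: (succ_ratio_step_level m_gt0 lt_mp f0 fm e f_incr l0_gt0 cond_l0 le_n).
move=> a b fE _; have pE := fE ord_max; rewrite fm /= in pE.
have chord_case : (a <= 0) || (m == 1%N) ->
    forall e : 'I_m.+1, (p * e <= m * f e)%N.
  move=> a_m e; rewrite -lez_nat !PoszM fE pE -subr_ge0.
  have le_em : (e%:Z <= m%:Z)%R by rewrite lez_nat -ltnS ltn_ord.
  (* The height of [f] above its chord is, up to the factor [m], - a e (m - e); it vanishes at both
     digits when m = 1. *)
  have -> : m%:Z * (a * e%:Z ^+ 2 + b * e%:Z) - (a * m%:Z ^+ 2 + b * m%:Z) * e%:Z =
      m%:Z * (- a * (e%:Z * (m%:Z - e%:Z))) by ring.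
  rewrite mulr_ge0 //; case/orP: a_m => [a_le0|/eqP m1].
    by rewrite mulr_ge0 ?oppr_ge0 // mulr_ge0 // subr_ge0.
  have : (e <= 1)%N by rewrite -[X in (_ <= X)%N]m1 -ltnS.
  have -> : m%:Z = 1 := congr1 Posz m1.
  by case: (nat_of_ord e) => [|[|k]] // _; rewrite ?mul0r ?subrr !mulr0.
have chord := inf_ratio_chord R m_gt0 lt_mp f0 fm (isT : (0 < 2)%N).
case: ifPn => [a_le0|].
  by have [|-> -> _] := chord; first by apply: chord_case; rewrite a_le0.
rewrite -ltNge => a_gt0; have [m1|m_neq1] := eqVneq m 1%N.
  have [|-> -> two_ge1] := chord; first by apply: chord_case; rewrite m1 orbT.
  by rewrite min_l.
have m_gt1 : (1 < m)%N by rewrite ltn_neqAle eq_sym m_neq1.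
case: a a_gt0 fE {pE chord_case chord} => // a a_gt0 fE.
have lt1 : (1 < m.+1)%N by rewrite ltnS.
set c : nat := f (Ordinal lt1).
have c_gt0 : (0 < c)%N by rewrite -f0 f_incr.
have bE : b = c%:Z - a%:Z by rewrite /c fE /=; ring.
have fER (x : 'I_m.+1) :
    (f x)%:R = a%:R * (x%:R * (x%:R - 1)) + c%:R * x%:R :> R.
  have -> : (f x)%:R = ((f x)%:Z)%:~R :> R by [].
  rewrite fE bE !(rmorphD, rmorphM, rmorphB, rmorphXn) /= -!pmulrn.
  by ring.
split; first exact: (inf_ratio_quad (R := R) m_gt0 lt_mp f0 fm m_gt1 a_gt0 c_gt0 fER).
exact: (min_succ_ratio_quad (R := R) m_gt0 lt_mp f0 fm m_gt1 a_gt0 c_gt0 fER).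
Qed.
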